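(* Let $P=\frac12P_1+\frac12P_2$, where $P_1$ is the uniform distribution on $L_1=\{(t,0):-1\le t\le1\}$ and $P_2$ is the uniform distribution on $L_2=\{(\cos t,\sin t):0\le t\le\pi\}$. Then, with decimal values understood as approximations correct to within one unit in the last displayed digit, the set $$\{(-0.634868,\,0.15471),\ (0,\,0.92798),\ (0.634868,\,0.15471)\}$$ forms an optimal set of three-means for $P$, and the quantization error for three-means is $V_3=0.147821$.
   Context: For a Borel probability measure $P$ on $\mathbb{R}^2$ with finite second moment, the $n$th quantization error is $V_n=V_n(P)=\inf\{\int\min_{a\in\alpha}\|x-a\|^2\,dP(x):\alpha\subset\mathbb{R}^2,\ \mathrm{card}(\alpha)\le n\}$; a set with at most $n$ points attaining the infimum is an optimal set of $n$-means. The measure $P$ has density (with respect to arc length) $\frac14$ on $L_1$ and $\frac1{2\pi}$ on $L_2$. The decimal convention means: there is an optimal set whose points have coordinates differing from the listed decimals by less than one unit in the last displayed digit (coordinates listed as $0$ being exactly $0$), and likewise for the quantization error. *)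

(* Defs.v *)
From HB Require Import structures.
From mathcomp Require Import all_boot all_order all_algebra.
From mathcomp Require Import all_classical all_reals all_analysis.
From mathcomp Require Import measurable_realfun.

Set Implicit Arguments.
Unset Strict Implicit.
Unset Printing Implicit Defensive.

Import Order.TTheory GRing.Theory Num.Theory.
Import numFieldNormedType.Exports.

Local Open Scope card_scope.
Local Open Scope classical_set_scope.
Local Open Scope ring_scope.

Section quantization.
Context {R : realType}.

(* The library's norm on the product R * R is the sup norm, hence this explicit
   squared Euclidean distance. *)
Definition sqdist (x a : R * R) : R := (x.1 - a.1) ^+ 2 + (x.2 - a.2) ^+ 2.

(* For a finite nonempty set alpha the infimum is the minimum of the squared
   distances; for alpha = set0 it is +oo. *)
Definition min_sqdist (alpha : set (R * R)) (x : R * R) : \bar R :=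
  ereal_inf [set (sqdist x a)%:E | a in alpha].

(* The product sigma-algebra carried by R * R is the Borel sigma-algebra of the
   plane. *)
Definition distortion (P : probability (R * R)%type R) (alpha : set (R * R)) :
    \bar R :=
  (\int[P]_x min_sqdist alpha x)%E.

Definition quantization_error (P : probability (R * R)%type R) (n : nat) :
    \bar R :=
  ereal_inf [set distortion P alpha | alpha in [set alpha | alpha #<= `I_n]].

Definition optimal_means (P : probability (R * R)%type R) (n : nat)
    (alpha : set (R * R)) : Prop :=
  alpha #<= `I_n /\ distortion P alpha = quantization_error P n.

End quantization.

Section mixed_distribution.
Context (R : realType).

(* The library's uniform distributions live on measurableTypeR R, a copy of R. *)
Definition diameter_param (t : measurableTypeR R) : R * R := (t, 0).
Definition semicircle_param (t : measurableTypeR R) : R * R :=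
  (cos (t : R), sin (t : R)).

Lemma measurable_diameter_param : measurable_fun setT diameter_param.
Proof. exact: measurable_fun_pair. Qed.

Lemma measurable_semicircle_param : measurable_fun setT semicircle_param.
Proof.
apply: measurable_fun_pair; apply: continuous_measurable_fun.
- exact: continuous_cos.
- exact: continuous_sin.
Qed.

HB.instance Definition _ :=
  isMeasurableFun.Build _ _ _ _ diameter_param measurable_diameter_param.
HB.instance Definition _ :=
  isMeasurableFun.Build _ _ _ _ semicircle_param measurable_semicircle_param.

Lemma ltrN11 : (-1 : R) < 1.
Proof. by rewrite gtrN ?ltr01. Qed.

(* Both parametrizations have unit speed and are injective, so that the images
   of the uniform distributions on [-1, 1] and [0, pi] are the normalized
   arc-length measures on the diameter and on the upper semicircle. *)
Definition uniform_diameter : probability (R * R)%type R :=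
  distribution (uniform_prob ltrN11) diameter_param.

Definition uniform_semicircle : probability (R * R)%type R :=
  distribution (uniform_prob (pi_gt0 R)) semicircle_param.

Definition mixed_distribution : set (R * R) -> \bar R :=
  measure_add (mscale (2^-1)%:nng uniform_diameter)
              (mscale (2^-1)%:nng uniform_semicircle).

HB.instance Definition _ := Measure.on mixed_distribution.

Lemma mixed_distributionE (A : set (R * R)) :
  mixed_distribution A = ((2^-1)%:E * uniform_diameter A +
                          (2^-1)%:E * uniform_semicircle A)%E.
Proof. by rewrite /mixed_distribution measure_addE. Qed.

Lemma mixed_distribution_setT : mixed_distribution setT = 1%E.
Proof.
rewrite mixed_distributionE !probability_setT !mule1 -EFinD.
by rewrite -[_ + _]mulr2n -[_ *+ 2]mulr_natr mulVf ?pnatr_eq0.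
Qed.

HB.instance Definition _ := Measure_isProbability.Build _ _ _
  mixed_distribution mixed_distribution_setT.

End mixed_distribution.

Arguments mixed_distribution : clear implicits.

(* Main.v *)
(* A lower bound for arbitrary centres p1, p2, p3 comes from weak duality: with
   f_i the squared distance to p_i, min f_i >= r - sum_i (r - f_i)^+ on the
   semicircle for every r, and each r - f_i is nonnegative exactly on an arc,
   because it is a harmonic of angular frequency one plus a negative constant
   when r < 1. Each centre is thus charged for an interval of the diameter and
   for an arc, and the arcs of different centres need no longer be disjoint: the
   multiplier r = 1 - nu, the squared distance from the optimal centres to the
   common boundary point of their cells, decouples the three cells. The lengths
   of the three intervals still add up to 2; the costs of the two extreme cells
   are bounded below by a polynomial [profile] of these lengths, and that of the
   middle cell by the complement of the two profiles, so that the sum is the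
   optimal value. For a given cell the best centre is the centroid, which
   leaves an inequality in at most three real variables. It is checked by branch
   and bound with affine arithmetic in the kernel, except near the points where
   equality holds; there an exact expansion makes it a positive quadratic
   form up to small factors.

   The optimal configuration depends on the boundary angle t, the root of
   [stationarity], which is enclosed by evaluating at two rational points. *)

From HB Require Import structures.
From Stdlib Require Import ZArith.
Require Import Defs.
From mathcomp Require Import all_boot all_order all_algebra.
From mathcomp Require Import all_classical all_reals all_analysis.
From mathcomp Require Import measurable_realfun.
From mathcomp Require Import ssrZ zify ring lra.

Set Implicit Arguments.
Unset Strict Implicit.
Unset Printing Implicit Defensive.

Import Order.TTheory GRing.Theory Num.Theory.
Import numFieldNormedType.Exports.

Local Open Scope classical_set_scope.
Local Open Scope ring_scope.
Delimit Scope Z_scope with Z.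

(** * Taylor bounds for sine and cosine *)

Section taylor.
Context {R : realType}.
Implicit Types x : R.

(** Decoupling forgets which arc belongs to which interval, so in the relaxed problem any of the
    three cells, not only the middle one, may be the cell without a share of the diameter; the
    relaxation thus has three minimisers. This dictates the polynomial. A lower bound for an end
    cell is at most [w0] at length 0, the minimal cost of a cell made of an arc only; its complement
    for a middle cell of length 1 beside an empty end interval is at most [w1], which forces at
    least [w0]. Likewise the minimisers with end intervals of length 1 force the value [w1] there,
    and contact from below in the interior forces the slope [lam]. Only the remaining term of [curv]
    is free: its factor [l] leaves the value at 0 untouched. The middle cell is the hard one,
    because its cost also depends on where its interval lies. As centres are sorted by abscissa, the
    lengths determine this position, and by reflection the shorter end length serves as the third
    variable. *)

Lemma le_of_derive_le (f g df dg : R -> R) :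
  (forall x, is_derive x 1 f (df x)) -> (forall x, is_derive x 1 g (dg x)) ->
  (forall x, 0 <= x -> df x <= dg x) -> f 0 <= g 0 ->
  forall x, 0 <= x -> f x <= g x.
Proof.
move=> hf hg hfg h0 x x0.
have hd (y : R) : is_derive y 1 (fun z => g z - f z) (dg y - df y).
  exact: is_deriveB.
suff : g 0 - f 0 <= g x - f x by lra.
apply: (@ger0_derive1_le_cc R (fun z => g z - f z) 0 x) => //.
- move=> y; rewrite in_itv/= => /andP[y0 _].
  rewrite derive1E; case: (hd y) => _ ->.
  by rewrite subr_ge0; apply: hfg; exact: ltW.
- apply: derivable_within_continuous => y _.
  by case: (hd y).
- by rewrite in_itv/= lexx.
- by rewrite in_itv/= lexx x0.
Qed.

Lemma norm_le_of_derive_le (f h df dh : R -> R) :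
  (forall x, is_derive x 1 f (df x)) -> (forall x, is_derive x 1 h (dh x)) ->
  (forall x, 0 <= x -> `|df x| <= dh x) -> f 0 = 0 -> h 0 = 0 ->
  forall x, 0 <= x -> `|f x| <= h x.
Proof.
move=> hf hh hfh f0 h0 x x0; rewrite ler_norml; apply/andP; split.
- apply: (@le_of_derive_le (fun z => - h z) f (fun z => - dh z) df) => //.
  + by move=> y y0; have := hfh y y0; rewrite ler_norml => /andP[].
  + by rewrite f0 h0 oppr0.
- apply: (@le_of_derive_le f h df dh) => //.
  + by move=> y y0; have := hfh y y0; rewrite ler_norml => /andP[].
  + by rewrite f0 h0.
Qed.

Definition taylor_cos n x : R :=
  \sum_(k < n) (-1) ^+ k / (k.*2)`!%:R * x ^+ k.*2.
Definition taylor_sin n x : R :=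
  \sum_(k < n) (-1) ^+ k / (k.*2.+1)`!%:R * x ^+ k.*2.+1.

Lemma is_derive_mono n (c x : R) :
  is_derive x 1 (fun z => c / n.+1`!%:R * z ^+ n.+1) (c / n`!%:R * x ^+ n).
Proof.
have h := is_deriveZ (c / n.+1`!%:R) (is_deriveX n.+1 (is_derive_id x 1)).
rewrite (_ : c / n`!%:R * x ^+ n =
  (c / n.+1`!%:R) *: ((n.+1%:R * id x ^+ n.+1.-1) *: 1)); last first.
  rewrite /GRing.scale/= factS natrM mulr1 mulrA; congr (_ * _).
  have : n`!%:R != 0 :> R by rewrite pnatr_eq0 -lt0n fact_gt0.
  have : n.+1%:R != 0 :> R by rewrite pnatr_eq0.
  by move: n.+1%:R n`!%:R => a b a0 b0; field; apply/andP; split.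
rewrite (_ : (fun z => _) = (c / n.+1`!%:R) \*: (@idfun R ^+ n.+1)) //.
by apply/funext => z; rewrite /= fctE.
Qed.

Lemma is_derive_taylor_sin n x :
  is_derive x 1 (taylor_sin n) (taylor_cos n x).
Proof.
elim: n => [|n ih].
  rewrite /taylor_cos big_ord0.
  rewrite (_ : taylor_sin 0 = cst 0); last first.
    by apply/funext => y; rewrite /taylor_sin big_ord0.
  exact: is_derive_cst.
rewrite (_ : taylor_sin n.+1 =
  taylor_sin n + (fun z => (-1) ^+ n / (n.*2.+1)`!%:R * z ^+ n.*2.+1)); last first.
  by apply/funext => y; rewrite /taylor_sin big_ord_recr.
rewrite /taylor_cos big_ord_recr/=.
by apply: is_deriveD; exact: is_derive_mono.
Qed.

Lemma is_derive_taylor_cos n x :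
  is_derive x 1 (taylor_cos n.+1) (- taylor_sin n x).
Proof.
elim: n => [|n ih].
  rewrite /taylor_sin big_ord0 oppr0.
  rewrite (_ : taylor_cos 1 = cst 1); last first.
    by apply/funext => y; rewrite /taylor_cos big_ord1 !expr0 invr1 !mulr1.
  exact: is_derive_cst.
rewrite (_ : taylor_cos n.+2 =
  taylor_cos n.+1 +
  (fun z => (-1) ^+ n.+1 / (n.*2.+2)`!%:R * z ^+ n.*2.+2)); last first.
  by apply/funext => y; rewrite /taylor_cos big_ord_recr.
rewrite /taylor_sin big_ord_recr/= opprD.
apply: is_deriveD.
have := @is_derive_mono n.*2.+1 ((-1) ^+ n.+1) x.
by rewrite exprS mulN1r !mulNr.
Qed.

(** The derivative of each remainder is, up to sign, a remainder of the other function, so the two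
    bounds are integrated in alternation, starting from the bound 1 on the cosine. *)
Lemma taylor_cos_sin_bound n :
  (forall x, 0 <= x -> `|cos x - taylor_cos n.+1 x| <=
     x ^+ n.+1.*2 / (n.+1.*2)`!%:R) /\
  (forall x, 0 <= x -> `|sin x - taylor_sin n.+1 x| <=
     x ^+ n.+1.*2.+1 / (n.+1.*2.+1)`!%:R).
Proof.
have step_cos m : (forall x, 0 <= x -> `|sin x - taylor_sin m x| <=
     x ^+ m.*2.+1 / (m.*2.+1)`!%:R) ->
   (forall x, 0 <= x -> `|cos x - taylor_cos m.+1 x| <=
     x ^+ m.+1.*2 / (m.+1.*2)`!%:R).
  move=> h; apply: (norm_le_of_derive_le
    (f := fun x => cos x - taylor_cos m.+1 x)
    (df := fun x => - (sin x - taylor_sin m x))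
    (dh := fun x => x ^+ m.*2.+1 / (m.*2.+1)`!%:R)).
  - move=> x; rewrite opprD.
    by apply: is_deriveB; exact: is_derive_taylor_cos.
  - move=> x; have := @is_derive_mono m.*2.+1 1 x.
    rewrite !div1r mulrC; congr (is_derive _ _ _ _).
    by apply/funext => z; rewrite mulrC.
  - by move=> x x0; rewrite normrN; exact: h.
  - rewrite cos0 /taylor_cos big_ord_recl/= expr0 invr1 !mulr1.
    by rewrite big1 ?addr0 ?subrr// => i _; rewrite expr0n/= mulr0.
  - by rewrite expr0n mul0r.
have step_sin m : (forall x, 0 <= x -> `|cos x - taylor_cos m x| <=
     x ^+ m.*2 / (m.*2)`!%:R) ->
   (forall x, 0 <= x -> `|sin x - taylor_sin m x| <=
     x ^+ m.*2.+1 / (m.*2.+1)`!%:R).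
  move=> h; apply: (norm_le_of_derive_le
    (f := fun x => sin x - taylor_sin m x)
    (df := fun x => cos x - taylor_cos m x)
    (dh := fun x => x ^+ m.*2 / (m.*2)`!%:R)).
  - by move=> x; apply: is_deriveB; exact: is_derive_taylor_sin.
  - move=> x; have := @is_derive_mono m.*2 1 x.
    rewrite !div1r mulrC; congr (is_derive _ _ _ _).
    by apply/funext => z; rewrite mulrC.
  - by move=> x x0; exact: h.
  - rewrite sin0 /taylor_sin.
    by rewrite big1 ?subrr// => i _; rewrite expr0n/= mulr0.
  - by rewrite expr0n mul0r.
have cosB m : forall x, 0 <= x -> `|cos x - taylor_cos m x| <=
     x ^+ m.*2 / (m.*2)`!%:R.
  elim: m => [x _|m ih]; last by apply: step_cos; exact: step_sin.
  by rewrite /taylor_cos big_ord0 subr0 expr0 divr1 cos_max.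
by split; [exact: cosB | exact: step_sin (cosB _)].
Qed.

Lemma taylor_cos_bound n x : `|cos x - taylor_cos n.+1 x| <=
  `|x| ^+ n.+1.*2 / (n.+1.*2)`!%:R.
Proof.
rewrite -[cos x]cos_norm (_ : taylor_cos n.+1 x = taylor_cos n.+1 `|x|).
  exact: (taylor_cos_sin_bound n).1.
rewrite /taylor_cos; apply: eq_bigr => i _.
by rewrite -mul2n !exprM real_normK ?num_real.
Qed.

Lemma taylor_sin_bound n x : 0 <= x -> `|sin x - taylor_sin n.+1 x| <=
  x ^+ n.+1.*2.+1 / (n.+1.*2.+1)`!%:R.
Proof. exact: (taylor_cos_sin_bound n).2. Qed.

End taylor.

(** * Affine arithmetic and branch and bound *)

(** Stands for values which, scaled by [2 ^ prec], equal [a0 + a1 * e1 + a2 * e2 + a3 * e3] up to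
    [aerr], with noises in [-1, 1], one for each coordinate of a box. Shared noises preserve
    correlations that intervals would lose. *)
Record affine_form :=
  Aff { a0 : Z; a1 : Z; a2 : Z; a3 : Z; aerr : Z }.

Definition aff_lin f : Z := (Z.abs (a1 f) + Z.abs (a2 f) + Z.abs (a3 f))%Z.
Definition aff_rad f : Z := (aff_lin f + aerr f)%Z.
Definition aff_low f : Z := (a0 f - aff_rad f)%Z.
Definition aff_cst c e : affine_form := Aff c 0 0 0 e.

Definition aff_add f g : affine_form :=
  Aff (a0 f + a0 g) (a1 f + a1 g) (a2 f + a2 g) (a3 f + a3 g)
      (aerr f + aerr g).

Definition aff_opp f : affine_form :=
  Aff (- a0 f) (- a1 f) (- a2 f) (- a3 f) (aerr f).

Section affine_arithmetic.
Variable prec : Z.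

Definition trunc (x : Z) : Z := Z.shiftr x prec.

(** Products of two deviations from the centres go into the error. Of the final [5], four units pay
    for rounding the coefficients and one for rounding the error itself. *)
Definition aff_mul f g : affine_form :=
  Aff (trunc (a0 f * a0 g))
      (trunc (a0 f * a1 g + a0 g * a1 f))
      (trunc (a0 f * a2 g + a0 g * a2 f))
      (trunc (a0 f * a3 g + a0 g * a3 f))
      (trunc (Z.abs (a0 f) * aerr g + Z.abs (a0 g) * aerr f
              + aff_rad f * aff_rad g) + 5).

Inductive pexpr :=
  | PVar of nat | PInt of Z
  | PAdd of pexpr & pexpr | PSub of pexpr & pexpr | PMul of pexpr & pexpr.

Fixpoint aff_eval (env : seq affine_form) (e : pexpr) : affine_form :=
  match e with
  | PVar i => nth (aff_cst 0 0) env i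
  | PInt z => aff_cst (Z.shiftl z prec) 0
  | PAdd e1 e2 => aff_add (aff_eval env e1) (aff_eval env e2)
  | PSub e1 e2 => aff_add (aff_eval env e1) (aff_opp (aff_eval env e2))
  | PMul e1 e2 => aff_mul (aff_eval env e1) (aff_eval env e2)
  end.

Fixpoint zfact (n : nat) : Z :=
  match n with O => 1%Z | S m => (Z.of_nat n * zfact m)%Z end.

Definition pow2 : Z := Z.shiftl 1 prec.

Definition cos_coeffs n : seq affine_form :=
  [seq aff_cst ((if odd k then - pow2 else pow2) * 16 ^ Z.of_nat k
                / zfact k.*2)%Z 1 | k <- iota 0 n].
Definition sin_coeffs n : seq affine_form :=
  [seq aff_cst ((if odd k then - pow2 else pow2) * 16 ^ Z.of_nat k
                / zfact k.*2.+1)%Z 1 | k <- iota 0 n].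
Definition taylor_rem n : Z := (pow2 * 4 ^ Z.of_nat n / zfact n + 1)%Z.

Definition aff_horner (cs : seq affine_form) (x : affine_form) :=
  foldr (fun c acc => aff_add c (aff_mul x acc)) (aff_cst 0 0) cs.

Definition aff_widen (f : affine_form) (r : Z) : affine_form :=
  Aff (a0 f) (a1 f) (a2 f) (a3 f) (aerr f + r).

(* The Taylor polynomials at [x = c / 2 ^ prec] in [0, 4] are evaluated as
   polynomials in [(x / 4) ^ 2], so that rounding errors are not amplified. *)
Definition point_sqr c : affine_form :=
  let y := aff_cst (Z.shiftr c 2) 1 in aff_mul y y.
Definition point_cos cs rem c : affine_form :=
  aff_widen (aff_horner cs (point_sqr c)) rem.
Definition point_sin cs rem c : affine_form :=
  aff_widen (aff_mul (aff_cst c 0) (aff_horner cs (point_sqr c))) rem.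

Definition interval_mid (b : Z * Z) : Z := Z.div2 (b.1 + b.2).
Definition interval_rad (b : Z * Z) : Z :=
  Z.max (b.2 - interval_mid b) (interval_mid b - b.1).

Definition cst_form (b : Z * Z) : affine_form :=
  aff_cst (interval_mid b) (interval_rad b).

Record trig_table :=
  TrigTable { tcos : seq affine_form; tsin : seq affine_form;
              rcos : Z; rsin : Z }.

Definition mk_trig_table n : trig_table :=
  TrigTable (cos_coeffs n) (sin_coeffs n) (taylor_rem n.*2)
    (taylor_rem n.*2.+1).

(** Tangents at the midpoint, so that sine and cosine stay correlated with the third coordinate; [q]
    covers the quadratic remainder. *)
Definition trig_forms (T : trig_table) (c r : Z) : affine_form * affine_form :=
  let fc := point_cos (tcos T) (rcos T) c in
  let fs := point_sin (tsin T) (rsin T) c in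
  let q := (trunc (r * r) + 2)%Z in
  (Aff (a0 fs) 0 0 (trunc (a0 fc * r))
     (aff_rad fs + trunc (aff_rad fc * r) + q + 2),
   Aff (a0 fc) 0 0 (trunc (- a0 fs * r))
     (aff_rad fc + trunc (aff_rad fs * r) + q + 2)).

Definition box := ((Z * Z) * (Z * Z) * (Z * Z))%type.

Definition box_env (T : trig_table) (cst : seq affine_form) (b : box) :
    seq affine_form :=
  let: (b1, b2, b3) := b in
  let c3 := interval_mid b3 in let r3 := interval_rad b3 in
  let: (fs, fc) := trig_forms T c3 r3 in
  [:: Aff (interval_mid b1) (interval_rad b1) 0 0 0,
      Aff (interval_mid b2) 0 (interval_rad b2) 0 0,
      Aff c3 0 0 r3 0, fs, fc & cst].

(** The remainders in the tables are valid on [0, 4] only, and the Taylor polynomials are evaluated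
    at the midpoint. *)
Definition box_ok (b : box) : bool :=
  let c3 := interval_mid b.2 in (0 <=? c3)%Z && (c3 <=? 4 * pow2)%Z.

(** With several expressions, of which one has to be positive on the whole box, a box can also be
    discarded because it violates a constraint. *)
Definition box_pos T cst es b : bool :=
  box_ok b &&
  (let env := box_env T cst b in
   has (fun e => 0 <? aff_low (aff_eval env e))%Z es).

Definition itv_sub (b c : Z * Z) : bool := ((c.1 <=? b.1) && (b.2 <=? c.2))%Z.
Definition box_sub (b c : box) : bool :=
  [&& itv_sub b.1.1 c.1.1, itv_sub b.1.2 c.1.2 & itv_sub b.2 c.2].

Definition itv_width (b : Z * Z) : Z := (b.2 - b.1)%Z.

Definition box_split (b : box) : box * box :=
  let: (b1, b2, b3) := b in
  let w1 := itv_width b1 in let w2 := itv_width b2 in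
  let w3 := itv_width b3 in
  if ((w2 <=? w1) && (w3 <=? w1))%Z then
    ((b1.1, interval_mid b1, b2, b3), (interval_mid b1, b1.2, b2, b3))
  else if (w3 <=? w2)%Z then
    ((b1, (b2.1, interval_mid b2), b3), (b1, (interval_mid b2, b2.2), b3))
  else
    ((b1, b2, (b3.1, interval_mid b3)), (b1, b2, (interval_mid b3, b3.2))).

(* Conditionals, because [||] and [&&] are strict under [vm_compute]. *)
Fixpoint branch_bound T cst es excl (fuel : nat) (b : box) : bool :=
  if has (box_sub b) excl then true else
  if box_pos T cst es b then true else
  match fuel with
  | O => false
  | S k => let: (l, r) := box_split b in
      if branch_bound T cst es excl k l
      then branch_bound T cst es excl k r else false
  end.

(* Outward rounding of the interval with end points [b.1 / d] and [b.2 / d]. *)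
Definition round_itv (d : Z) (b : Z * Z) : Z * Z :=
  (pow2 * b.1 / d, - (pow2 * - b.2 / d))%Z.

Definition scale_itv (k : Z) (b : Z * Z) : Z * Z :=
  (Z.shiftl b.1 (prec - k), Z.shiftl b.2 (prec - k)).
Definition scale_box (k : Z) (b : box) : box :=
  (scale_itv k b.1.1, scale_itv k b.1.2, scale_itv k b.2).

End affine_arithmetic.

Declare Scope pexpr_scope.
Delimit Scope pexpr_scope with px.
Bind Scope pexpr_scope with pexpr.
Notation "e1 + e2" := (PAdd e1 e2) : pexpr_scope.
Notation "e1 - e2" := (PSub e1 e2) : pexpr_scope.
Notation "e1 * e2" := (PMul e1 e2) : pexpr_scope.
Notation "# i" := (PVar i) (at level 1, format "# i") : pexpr_scope.
Notation "z %:I" := (PInt z%Z) (at level 2, format "z %:I") : pexpr_scope.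

(* Locked, lest unification computes with unary numerals. *)
HB.lock Definition zr (R : realType) (z : Z) : R := (int_of_Z z)%:~R.
Arguments zr {R} z.

(** * Soundness of affine arithmetic *)

Section affine_soundness.
Context {R : realType}.
Implicit Types (v w x e : R).
Local Notation zr := (@zr R).

Lemma zrD a b : zr (a + b)%Z = zr a + zr b.
Proof. by rewrite !zr.unlock -intrD; congr _%:~R; lia. Qed.
Lemma zrN a : zr (- a)%Z = - zr a.
Proof. by rewrite !zr.unlock -mulrNz; congr _%:~R; lia. Qed.
Lemma zrB a b : zr (a - b)%Z = zr a - zr b.
Proof. by rewrite -zrN -zrD. Qed.
Lemma zrM a b : zr (a * b)%Z = zr a * zr b.
Proof. by rewrite !zr.unlock -intrM; congr _%:~R; lia. Qed.
Lemma zr0 : zr 0 = 0. Proof. by rewrite zr.unlock. Qed.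
Lemma zr1 : zr 1 = 1. Proof. by rewrite zr.unlock. Qed.
Lemma zr_le a b : (zr a <= zr b) = (a <=? b)%Z.
Proof. by rewrite !zr.unlock ler_int; lia. Qed.
Lemma zr_lt a b : (zr a < zr b) = (a <? b)%Z.
Proof. by rewrite !zr.unlock ltr_int; lia. Qed.
Lemma zr_abs a : zr (Z.abs a) = `|zr a|.
Proof. by rewrite !zr.unlock -intr_norm; congr _%:~R; lia. Qed.
Lemma zr_nat n : zr (Z.of_nat n) = n%:R.
Proof. by rewrite !zr.unlock pmulrn; congr _%:~R; lia. Qed.
Lemma zr_exp a n : zr (a ^ Z.of_nat n)%Z = zr a ^+ n.
Proof.
elim: n => [|n ih]; first by rewrite expr0 -zr1.
by rewrite Nat2Z.inj_succ Z.pow_succ_r ?zrM ?ih ?exprS; last lia.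
Qed.

Lemma zr_div a d : (0 < d)%Z ->
  zr (a / d)%Z <= zr a / zr d /\ zr a / zr d - 1 <= zr (a / d)%Z.
Proof.
move=> d0; have zd0 : 0 < zr d by rewrite -zr0 zr_lt; lia.
rewrite ler_pdivlMr // lerBlDr ler_pdivrMr // -zr1 -zrD -!zrM !zr_le.
have := Z.mod_pos_bound a d d0; have := Z.div_mod a d; nia.
Qed.

Variable prec : Z.
Hypothesis prec_ge0 : (0 <= prec)%Z.
Let S : R := zr (pow2 prec).

Lemma pow2E : pow2 prec = (2 ^ prec)%Z.
Proof. by rewrite /pow2 Z.shiftl_mul_pow2 // Z.mul_1_l. Qed.

Lemma pow2_gt0 : (0 < pow2 prec)%Z.
Proof. by rewrite pow2E; apply: Z.pow_pos_nonneg; lia. Qed.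

Lemma S_gt0 : 0 < S.
Proof. by rewrite /S -zr0 zr_lt; have := pow2_gt0; lia. Qed.

Lemma zr_trunc a : `|zr (trunc prec a) - zr a / S| <= 1.
Proof.
rewrite /trunc Z.shiftr_div_pow2 // -pow2E.
have [] := zr_div a pow2_gt0; rewrite -/S => h1 h2.
by rewrite ler_norml; lra.
Qed.

Lemma zr_trunc_ge a : zr a / S - 1 <= zr (trunc prec a).
Proof. by have := zr_trunc a; rewrite ler_norml => /andP[]; lra. Qed.

Section enc.
Variables e1 e2 e3 : R.
Hypotheses (he1 : `|e1| <= 1) (he2 : `|e2| <= 1) (he3 : `|e3| <= 1).

Definition encloses (f : affine_form) v : Prop :=
  `|v * S - (zr (a0 f) + (zr (a1 f) * e1 + zr (a2 f) * e2 + zr (a3 f) * e3))|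
    <= zr (aerr f).

Lemma norm_mul_le1 a e : `|e| <= 1 -> `|a * e| <= `|a|.
Proof. by move=> h; rewrite normrM ler_piMr. Qed.

Lemma lin_le f :
  `|zr (a1 f) * e1 + zr (a2 f) * e2 + zr (a3 f) * e3| <= zr (aff_lin f).
Proof.
rewrite /aff_lin !zrD !zr_abs.
apply: (le_trans (ler_normD _ _)); apply: lerD; last exact: norm_mul_le1.
apply: (le_trans (ler_normD _ _)).
by apply: lerD; exact: norm_mul_le1.
Qed.

Lemma encloses_rad f v : encloses f v ->
  `|v * S - zr (a0 f)| <= zr (aff_rad f).
Proof.
rewrite /encloses /aff_rad zrD => h.
have := lin_le f; move: h; set l := _ + _ * e3 => h hl.
have -> : v * S - zr (a0 f) = l + (v * S - (zr (a0 f) + l)) by ring.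
by apply: (le_trans (ler_normD _ _)); apply: lerD.
Qed.

Lemma encloses_low f v : encloses f v -> zr (aff_low f) <= v * S.
Proof.
move=> /encloses_rad; rewrite /aff_low zrB ler_norml => /andP[]; lra.
Qed.

Lemma encloses_pos f v : encloses f v -> (0 <? aff_low f)%Z -> 0 < v.
Proof.
move=> /encloses_low h; rewrite -zr_lt zr0 => h0.
by rewrite -(pmulr_lgt0 _ S_gt0); apply: lt_le_trans h.
Qed.

Lemma encloses_add f g v w :
  encloses f v -> encloses g w -> encloses (aff_add f g) (v + w).
Proof.
rewrite /encloses /aff_add/= !zrD => hv hw.
apply: le_trans (lerD hv hw); apply: le_trans (ler_normD _ _).
by rewrite le_eqVlt; apply/orP; left; apply/eqP; congr `|_|; ring.
Qed.

Lemma encloses_opp f v : encloses f v -> encloses (aff_opp f) (- v).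
Proof.
rewrite /encloses /aff_opp/= !zrN => hv.
by rewrite -normrN; apply: le_trans hv; rewrite le_eqVlt; apply/orP; left;
  apply/eqP; congr `|_|; ring.
Qed.

Lemma encloses_cst c r v : `|v * S - zr c| <= zr r ->
  encloses (aff_cst c r) v.
Proof. by rewrite /encloses /aff_cst/= !zr0 !mul0r !addr0. Qed.

Lemma encloses_int z : encloses (aff_cst (Z.shiftl z prec) 0) (zr z).
Proof.
apply: encloses_cst; rewrite Z.shiftl_mul_pow2 // -pow2E zrM -/S.
by rewrite subrr normr0 zr0.
Qed.

Lemma encloses_mul f g v w :
  encloses f v -> encloses g w -> encloses (aff_mul prec f g) (v * w).
Proof.
move=> hv hw; have S0 := S_gt0.
have rv := encloses_rad hv; have rw := encloses_rad hw.
move: hv hw; rewrite /encloses /aff_mul/=.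
set t0 := trunc prec (a0 f * a0 g); have := zr_trunc (a0 f * a0 g).
rewrite -/t0; move: t0 => t0.
set t1 := trunc prec (a0 f * a1 g + _); have := zr_trunc (a0 f * a1 g + a0 g * a1 f).
rewrite -/t1; move: t1 => t1.
set t2 := trunc prec (a0 f * a2 g + _); have := zr_trunc (a0 f * a2 g + a0 g * a2 f).
rewrite -/t2; move: t2 => t2.
set t3 := trunc prec (a0 f * a3 g + _); have := zr_trunc (a0 f * a3 g + a0 g * a3 f).
rewrite -/t3; move: t3 => t3.
set r := (_ + aff_rad f * aff_rad g)%Z; have := zr_trunc_ge r.
rewrite /r zrD; move: (trunc prec _) => tr.
rewrite !zrD !zrM !zr_abs (zr_nat 5 : zr 5 = 5).
move: rv rw.
set F0 := zr (a0 f); set G0 := zr (a0 g).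
set F1 := zr (a1 f); set G1 := zr (a1 g).
set F2 := zr (a2 f); set G2 := zr (a2 g).
set F3 := zr (a3 f); set G3 := zr (a3 g).
set T0 := zr t0; set T1 := zr t1; set T2 := zr t2; set T3 := zr t3.
move: (zr (aff_rad f)) (zr (aff_rad g)) (zr (aerr f)) (zr (aerr g)) (zr tr).
move=> rf rg ef eg TR rv rw hr h3 h2 h1 h0 hv hw.
set lf := F1 * e1 + _ + _ in hv; set lg := G1 * e1 + _ + _ in hw.
(* Exact splitting: the error of each factor times the other centre, the product of the two
   deviations, and the four rounding errors. *)
have -> : v * w * S - (T0 + (T1 * e1 + T2 * e2 + T3 * e3)) =
  (F0 * (w * S - (G0 + lg)) / S + G0 * (v * S - (F0 + lf)) / S
   + (v * S - F0) * (w * S - G0) / S)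
  - ((T0 - F0 * G0 / S) + ((T1 - (F0 * G1 + G0 * F1) / S) * e1
    + (T2 - (F0 * G2 + G0 * F2) / S) * e2
    + (T3 - (F0 * G3 + G0 * F3) / S) * e3)).
  rewrite /lf /lg; field; exact: lt0r_neq0.
have k1 := le_trans (norm_mul_le1 _ he1) h1.
have k2 := le_trans (norm_mul_le1 _ he2) h2.
have k3 := le_trans (norm_mul_le1 _ he3) h3.
have b (a c k l : R) : `|a| <= k -> `|c| <= l -> `|a * c / S| <= k * l / S.
  move=> ak cl; rewrite normrM normfV (gtr0_norm S0).
  by rewrite ler_pM2r ?invr_gt0 // normrM ler_pM.
have b1 := b _ _ _ _ (lexx `|F0|) hw.
have b2 := b _ _ _ _ (lexx `|G0|) hv.
have b3 := b _ _ _ _ rv rw.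
move: k1 k2 k3 b1 b2 b3 h0 hr; rewrite !mulrDl.
move: (_ * e1) (_ * e2) (_ * e3) (F0 * _ / S) (G0 * _ / S).
move: (_ * (_ - G0) / S) (T0 - _) (`|F0| * _ / S) (`|G0| * _ / S) (_ * _ / S).
move=> x1 x2 x3 x4 x5 x6 x7 x8 x9 x10; rewrite !ler_norml.
do ![case/andP=> ? ?]; move=> ?.
by apply/andP; split; lra.
Qed.

Fixpoint peval (env : seq R) (p : pexpr) : R :=
  match p with
  | PVar i => nth 0 env i
  | PInt z => zr z
  | PAdd p1 p2 => peval env p1 + peval env p2
  | PSub p1 p2 => peval env p1 - peval env p2
  | PMul p1 p2 => peval env p1 * peval env p2
  end.

Inductive encloses_seq : seq affine_form -> seq R -> Prop :=
  | encloses_nil : encloses_seq [::] [::]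
  | encloses_cons f v fs vs : encloses f v -> encloses_seq fs vs ->
      encloses_seq (f :: fs) (v :: vs).

Lemma encloses_nth fs vs i : encloses_seq fs vs ->
  encloses (nth (aff_cst 0 0) fs i) (nth 0 vs i).
Proof.
have h0 : encloses (aff_cst 0 0) 0.
  by apply: encloses_cst; rewrite zr0 mul0r subrr normr0.
by move=> h; elim: h i => [|f v {}fs {}vs hf _ ih] [|i] //=.
Qed.

Lemma aff_eval_sound fenv env p : encloses_seq fenv env ->
  encloses (aff_eval prec fenv p) (peval env p).
Proof.
move=> henv; elim: p => [i|z|p1 h1 p2 h2|p1 h1 p2 h2|p1 h1 p2 h2] /=.
- exact: encloses_nth.
- exact: encloses_int.
- exact: encloses_add.
- by apply: encloses_add => //; exact: encloses_opp.
- exact: encloses_mul.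
Qed.

Lemma encloses_widen f r v w : encloses f v -> `|w - v| * S <= zr r ->
  encloses (aff_widen f r) w.
Proof.
rewrite /encloses /aff_widen/= zrD => hv hw; have S0 := S_gt0.
have {}hw : `|(w - v) * S| <= zr r by rewrite normrM (gtr0_norm S0).
move: hv hw; rewrite mulrBl !ler_norml => /andP[? ?] /andP[? ?].
by apply/andP; split; lra.
Qed.

Lemma aff_horner_sound cs as_ fx x :
  encloses fx x -> encloses_seq cs as_ ->
  encloses (aff_horner prec cs fx)
    (foldr (fun a acc => a + x * acc) 0 as_).
Proof.
move=> hx; elim=> [|f v fs vs hf _ ih] /=.
  by apply: encloses_cst; rewrite zr0 mul0r subrr normr0.
by apply: encloses_add => //; exact: encloses_mul.
Qed.

Lemma foldr_hornerE (f : nat -> R) n x :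
  foldr (fun a acc => a + x * acc) 0 [seq f k | k <- iota 0 n] =
  \sum_(k < n) f k * x ^+ k.
Proof.
elim: n f => [|n ih] f; first by rewrite big_ord0.
rewrite big_ord_recl/= expr0 mulr1.
have -> : iota 1 n = [seq (1 + k)%N | k <- iota 0 n] by exact: (iotaDl 1 0 n).
rewrite -map_comp.
rewrite (ih (f \o addn 1)) mulr_sumr; congr (_ + _).
by apply: eq_bigr => i _; rewrite mulrCA exprS.
Qed.

Lemma zfactE n : zr (zfact n) = n`!%:R.
Proof. by elim: n => [|n ih]; rewrite ?zr1 // factS natrM -ih -zr_nat -zrM. Qed.

Lemma zfact_gt0 n : (0 < zfact n)%Z.
Proof. by elim: n => [//|n ih]; rewrite /zfact -/zfact; lia. Qed.

Lemma encloses_coeff k m :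
  encloses (aff_cst ((if odd k then - pow2 prec else pow2 prec)
                     * 16 ^ Z.of_nat k / zfact m)%Z 1)
    ((-1) ^+ k * 16 ^+ k / m`!%:R).
Proof.
apply: encloses_cst; set a := (_ * _)%Z.
have -> : (-1) ^+ k * 16 ^+ k / m`!%:R * S = zr a / zr (zfact m).
  rewrite /a zrM zr_exp zfactE -signr_odd.
  by case: (odd k); rewrite ?zrN -/S ?expr0 ?expr1 (zr_nat 16 : zr 16 = 16);
    field; rewrite pnatr_eq0 -lt0n fact_gt0.
have [] := zr_div a (zfact_gt0 m); rewrite ler_norml zr1; lra.
Qed.

Lemma encloses_coeffs (m : nat -> nat) n :
  encloses_seq
    [seq aff_cst ((if odd k then - pow2 prec else pow2 prec)
                  * 16 ^ Z.of_nat k / zfact (m k))%Z 1 | k <- iota 0 n]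
    [seq (-1) ^+ k * 16 ^+ k / (m k)`!%:R | k <- iota 0 n].
Proof.
elim: (iota 0 n) => [|k s ih] /=; first exact: encloses_nil.
by apply: encloses_cons => //; exact: encloses_coeff.
Qed.

Lemma taylor_cosE n x : taylor_cos n x =
  foldr (fun a acc => a + (x / 4) * (x / 4) * acc) 0
    [seq (-1) ^+ k * 16 ^+ k / (k.*2)`!%:R | k <- iota 0 n].
Proof.
rewrite (foldr_hornerE (fun k => (-1) ^+ k * 16 ^+ k / (k.*2)`!%:R)).
apply: eq_bigr => i _; rewrite -mul2n exprM.
have -> : x ^+ 2 = 16 * (x / 4 * (x / 4)) by field.
rewrite exprMn; ring.
Qed.

Lemma taylor_sinE n x : taylor_sin n x = x *
  foldr (fun a acc => a + (x / 4) * (x / 4) * acc) 0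
    [seq (-1) ^+ k * 16 ^+ k / (k.*2.+1)`!%:R | k <- iota 0 n].
Proof.
rewrite (foldr_hornerE (fun k => (-1) ^+ k * 16 ^+ k / (k.*2.+1)`!%:R)).
rewrite mulr_sumr; apply: eq_bigr => i _; rewrite exprS -mul2n exprM.
have -> : x ^+ 2 = 16 * (x / 4 * (x / 4)) by field.
rewrite exprMn; ring.
Qed.

Lemma taylor_rem_ge n x : 0 <= x <= 4 ->
  x ^+ n / n`!%:R * S <= zr (taylor_rem prec n).
Proof.
move=> /andP[x0 x4]; rewrite /taylor_rem zrD zr1.
have [_] := zr_div (pow2 prec * 4 ^ Z.of_nat n) (zfact_gt0 n).
rewrite zrM zr_exp zfactE -/S (zr_nat 4 : zr 4 = 4) => h.
suff : x ^+ n / n`!%:R * S <= S * 4 ^+ n / n`!%:R by lra.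
have S0 := S_gt0; rewrite mulrAC ler_pM2r ?invr_gt0 ?ltr0n ?fact_gt0 //.
by rewrite mulrC ler_pM2l //; apply: lerXn2r => //; rewrite nnegrE // ler0n.
Qed.

Lemma encloses_sqr c : encloses (point_sqr prec c)
  (zr c / S / 4 * (zr c / S / 4)).
Proof.
have S0 := S_gt0.
suff h : encloses (aff_cst (Z.shiftr c 2) 1) (zr c / S / 4).
  exact: encloses_mul.
apply: encloses_cst; rewrite Z.shiftr_div_pow2 //.
have [] := @zr_div c (2 ^ 2)%Z erefl; rewrite (zr_nat 4 : zr (2 ^ 2) = 4).
have -> : zr c / S / 4 * S = zr c / 4 by field; exact: lt0r_neq0.
by rewrite ler_norml zr1; lra.
Qed.

Lemma point_cos_sound n c : (0 <= c <= 4 * pow2 prec)%Z ->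
  encloses (point_cos prec (cos_coeffs prec n.+1)
              (taylor_rem prec n.+1.*2) c) (cos (zr c / S)).
Proof.
move=> [c0 c4]; have S0 := S_gt0; set x := zr c / S.
have x4 : 0 <= x <= 4.
  apply/andP; split.
    by rewrite /x; apply: divr_ge0 (ltW S0); rewrite -zr0 zr_le; lia.
  by rewrite ler_pdivrMr // -(zr_nat 4 : zr 4 = 4) /S -zrM zr_le; lia.
rewrite /point_cos; apply: (@encloses_widen _ _ (taylor_cos n.+1 x)).
  rewrite taylor_cosE; apply: aff_horner_sound; first exact: encloses_sqr.
  exact: (encloses_coeffs double).
apply: le_trans (taylor_rem_ge n.+1.*2 x4).
rewrite ler_pM2r //; apply: le_trans (taylor_cos_bound n x) _.
by rewrite ger0_norm //; case/andP: x4.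
Qed.

Lemma point_sin_sound n c : (0 <= c <= 4 * pow2 prec)%Z ->
  encloses (point_sin prec (sin_coeffs prec n.+1)
              (taylor_rem prec n.+1.*2.+1) c) (sin (zr c / S)).
Proof.
move=> [c0 c4]; have S0 := S_gt0; set x := zr c / S.
have x4 : 0 <= x <= 4.
  apply/andP; split.
    by rewrite /x; apply: divr_ge0 (ltW S0); rewrite -zr0 zr_le; lia.
  by rewrite ler_pdivrMr // -(zr_nat 4 : zr 4 = 4) /S -zrM zr_le; lia.
rewrite /point_sin; apply: (@encloses_widen _ _ (taylor_sin n.+1 x)).
  rewrite taylor_sinE; apply: encloses_mul.
    by apply: encloses_cst; rewrite /x divfK ?subrr ?normr0 ?zr0 ?lt0r_neq0.
  apply: aff_horner_sound; first exact: encloses_sqr.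
  exact: (encloses_coeffs (fun k => k.*2.+1)).
apply: le_trans (taylor_rem_ge n.+1.*2.+1 x4).
rewrite ler_pM2r //; apply: taylor_sin_bound.
by case/andP: x4.
Qed.

End enc.
End affine_soundness.

(** * Soundness of the trigonometric forms and of branch and bound *)

Section branch_bound_soundness.
Context {R : realType}.
Implicit Types (v w x d : R).

Lemma trig_remainder (a b d : R) : `|a| <= 1 -> `|b| <= 1 ->
  `|a * (cos d - 1) + b * (sin d - d)| <= d ^+ 2.
Proof.
move=> ha hb; have c1 : `|cos d - 1| <= d ^+ 2 / 2.
  have := taylor_cos_bound 0 d.
  by rewrite /taylor_cos big_ord1 expr0 /= divr1 mulr1 real_normK ?num_real.
(* Up to 3 the cubic remainder of the sine is at most [d ^+ 2 / 2]; beyond 3 the trivial bound, 3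
   plus the absolute value of [d], is below [d ^+ 2]. *)
have [d3|d3] := lerP `|d| 3; last first.
  apply: (@le_trans _ _ (2 + (1 + `|d|))).
    apply: (le_trans (ler_normD _ _)); apply: lerD; rewrite normrM.
      apply: (@le_trans _ _ `|cos d - 1|); first exact: ler_piMl.
      have := cos_geN1 d; have := cos_le1 d.
      by rewrite ler_norml => ? ?; apply/andP; split; lra.
    apply: (@le_trans _ _ `|sin d - d|); first exact: ler_piMl.
    apply: (le_trans (ler_normB _ _)); apply: lerD => //; exact: sin_max.
  by rewrite -[d ^+ 2]real_normK ?num_real //; nra.
have s1 : `|sin d - d| <= d ^+ 2 / 2.
  have key (y : R) : 0 <= y -> y <= 3 -> `|sin y - y| <= y ^+ 2 / 2.
    move=> y0 y3; have := taylor_sin_bound 0 y0.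
    rewrite /taylor_sin big_ord1 expr0 /= divr1 mul1r expr1 => h.
    apply: (le_trans h); rewrite (_ : 3`!%:R = 6) // [_ ^+ 3]exprS; nra.
  have [d0|d0] := lerP 0 d; first by apply: key => //; rewrite -(ger0_norm d0).
  have := key (- d); rewrite sinN sqrrN -normrN opprB opprK [- d + _]addrC.
  by apply; rewrite ?oppr_ge0 ?(ltW d0) // -(ltr0_norm d0).
apply: (le_trans (ler_normD _ _)); rewrite !normrM.
have -> : d ^+ 2 = d ^+ 2 / 2 + d ^+ 2 / 2 by field.
by apply: lerD; [apply: le_trans c1|apply: le_trans s1]; exact: ler_piMl.
Qed.

Variable prec : Z.
Hypothesis prec_ge0 : (0 <= prec)%Z.
Let S : R := zr (pow2 prec).

Lemma itv_mid_rad v b : zr b.1 <= v * S <= zr b.2 ->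
  `|v * S - zr (interval_mid b)| <= zr (interval_rad b).
Proof.
move=> /andP[h1 h2]; rewrite ler_norml.
have : zr (b.2 - interval_mid b) <= zr (interval_rad b) :> R.
  by rewrite zr_le /interval_rad; lia.
have : zr (interval_mid b - b.1) <= zr (interval_rad b) :> R.
  by rewrite zr_le /interval_rad; lia.
by rewrite !zrB => ? ?; apply/andP; split; lra.
Qed.

Lemma itv_noise v b : zr b.1 <= v * S <= zr b.2 ->
  exists2 e : R, `|e| <= 1 &
    v * S = zr (interval_mid b) + zr (interval_rad b) * e.
Proof.
move=> /itv_mid_rad; move: (interval_mid b) (interval_rad b) => c r h.
have [r0|r0] := eqVneq (zr r : R) 0.
  exists 0; first by rewrite normr0.
  by move: h; rewrite r0 normr_le0 subr_eq0 => /eqP ->; rewrite mul0r addr0.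
have {}r0 : 0 < (zr r : R) by rewrite lt_neqAle eq_sym r0 (le_trans _ h).
exists ((v * S - zr c) / zr r); last by rewrite [zr r * _]mulrC divfK ?gt_eqF // addrC subrK.
by rewrite normrM normfV (gtr0_norm r0) ler_pdivrMr // mul1r.
Qed.

Lemma cst_form_sound e1 e2 e3 v b : zr b.1 <= v * S <= zr b.2 ->
  encloses prec e1 e2 e3 (cst_form b) v.
Proof. by move=> /itv_mid_rad h; exact: encloses_cst. Qed.

Lemma trig_forms_sound n e1 e2 e3 c r v :
  `|e1| <= 1 -> `|e2| <= 1 -> `|e3| <= 1 ->
  (0 <= c <= 4 * pow2 prec)%Z -> 0 <= (zr r : R) -> v * S = zr c + zr r * e3 ->
  encloses prec e1 e2 e3
    (trig_forms prec (mk_trig_table prec n.+1) c r).1 (sin v) /\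
  encloses prec e1 e2 e3
    (trig_forms prec (mk_trig_table prec n.+1) c r).2 (cos v).
Proof.
move=> h1 h2 h3 hc r0 hv; have S0 : 0 < S := S_gt0 prec_ge0.
have := encloses_rad h1 h2 h3 (point_cos_sound prec_ge0 h1 h2 h3 n hc).
have := encloses_rad h1 h2 h3 (point_sin_sound prec_ge0 h1 h2 h3 n hc).
rewrite -/S /trig_forms /mk_trig_table; cbv zeta.
cbn [tcos tsin rcos rsin fst snd].
move: (point_cos _ _ _ _) (point_sin _ _ _ _) => Fc Fs.
set m := zr c / S; set d := zr r * e3 / S.
have -> : v = m + d.
  by apply: (mulIf (lt0r_neq0 S0)); rewrite hv /m /d; field; exact: lt0r_neq0.
(* One computation serves both functions: [p] and [p'] are the value and the derivative at the
   midpoint [m], and [q] is the value at [m + d]. *)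
have core (p p' q : R) (F G : affine_form) (w : Z) :
    `|p * S - zr (a0 F)| <= zr (aff_rad F) ->
    `|p' * S - zr w| <= zr (aff_rad G) ->
    `|q - p - p' * d| <= d ^+ 2 ->
    encloses prec e1 e2 e3 (Aff (a0 F) 0 0 (trunc prec (w * r))
     (aff_rad F + trunc prec (aff_rad G * r) +
        (trunc prec (r * r) + 2) + 2)) q.
  move=> hp hp' hq; rewrite /encloses/= -/S !zr0 !mul0r !add0r.
  have k1 : `|(q - p - p' * d) * S| <= zr r * zr r / S.
    rewrite normrM (gtr0_norm S0).
    apply: (@le_trans _ _ (d ^+ 2 * S)); first by rewrite ler_pM2r.
    have -> : d ^+ 2 * S = (zr r * zr r / S) * e3 ^+ 2.
      by rewrite /d; field; exact: lt0r_neq0.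
    apply: ler_piMr; first by rewrite divr_ge0 ?mulr_ge0 ?(ltW S0).
    by rewrite -[e3 ^+ 2]real_normK ?num_real // expr_le1.
  have k2 : `|(p' * S - zr w) * (zr r * e3) / S| <= zr (aff_rad G) * zr r / S.
    rewrite normrM normfV (gtr0_norm S0) ler_pM2r ?invr_gt0 // normrM.
    apply: ler_pM => //; rewrite -[leRHS](ger0_norm r0).
    exact: norm_mul_le1.
  have k3 := le_trans (norm_mul_le1 _ h3) (zr_trunc prec_ge0 (w * r)).
  have k4 := @zr_trunc_ge R _ prec_ge0 (aff_rad G * r).
  have k5 := @zr_trunc_ge R _ prec_ge0 (r * r).
  move: (aff_rad F) (aff_rad G) hp hp' k2 k4 => rF rG hp _ k2 k4.
  move: k3 k4 k5; rewrite !zrD !zrM -/S (zr_nat 2 : zr 2 = 2 :> R).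
  move: (trunc prec (w * r)) (trunc prec (rG * r)) (trunc prec (r * r)).
  move=> t1 t2 t3.
  have -> : q * S - (zr (a0 F) + zr t1 * e3) =
    (q - p - p' * d) * S + (p * S - zr (a0 F))
    + (p' * S - zr w) * (zr r * e3) / S
    - (zr t1 - zr w * zr r / S) * e3.
    by rewrite /d; field; exact: lt0r_neq0.
  move: k1 k2 hp; rewrite !ler_norml.
  do ![case/andP=> ? ?] => ? ?; by apply/andP; split; lra.
move=> hs hco; split.
- apply: (core (sin m) (cos m) _ Fs Fc (a0 Fc) hs hco); rewrite sinD.
  have -> : sin m * cos d + cos m * sin d - sin m - cos m * d =
    sin m * (cos d - 1) + cos m * (sin d - d) by ring.
  by apply: trig_remainder; rewrite ?sin_max ?cos_max.
- apply: (core (cos m) (- sin m) _ Fc Fs (- a0 Fs)%Z hco).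
    by rewrite zrN -normrN; move: hs; congr (`|_| <= _); ring.
  rewrite cosD.
  have -> : cos m * cos d - sin m * sin d - cos m - - sin m * d =
    cos m * (cos d - 1) + - sin m * (sin d - d) by ring.
  by apply: trig_remainder; rewrite ?normrN ?sin_max ?cos_max.
Qed.

Definition in_itv2 (b : Z * Z) v : Prop := zr b.1 <= v * S <= zr b.2.
Definition in_box (b : box) v1 v2 v3 : Prop :=
  [/\ in_itv2 b.1.1 v1, in_itv2 b.1.2 v2 & in_itv2 b.2 v3].

Inductive in_csts : seq (Z * Z) -> seq R -> Prop :=
  | in_csts_nil : in_csts [::] [::]
  | in_csts_cons b v bs vs : in_itv2 b v -> in_csts bs vs ->
      in_csts (b :: bs) (v :: vs).

(* In a [pexpr], [#0], [#1], [#2] are the coordinates of the box, [#3] and [#4]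
   the sine and cosine of [#2], and the constants come from [#5] on. *)
Definition trig_env v1 v2 v3 cs : seq R :=
  [:: v1, v2, v3, sin v3, cos v3 & cs].

Lemma box_env_sound n bs cs b v1 v2 v3 : in_csts bs cs -> box_ok prec b ->
  in_box b v1 v2 v3 ->
  exists e1 e2 e3 : R, [/\ `|e1| <= 1, `|e2| <= 1, `|e3| <= 1 &
    encloses_seq prec e1 e2 e3
      (box_env prec (mk_trig_table prec n.+1) (map cst_form bs) b)
      (trig_env v1 v2 v3 cs)].
Proof.
move=> hcs; case: b => -[b1 b2] b3 hok [hb1 hb2 hb3].
have /itv_noise[e1 h1 w1] : in_itv2 b1 v1 := hb1.
have /itv_noise[e2 h2 w2] : in_itv2 b2 v2 := hb2.
have {}hb3 : in_itv2 b3 v3 := hb3.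
have /itv_noise[e3 h3 w3] := hb3.
exists e1, e2, e3; split => //.
have r3 : 0 <= (zr (interval_rad b3) : R).
  exact: le_trans (normr_ge0 _) (itv_mid_rad hb3).
have hc : (0 <= interval_mid b3 <= 4 * pow2 prec)%Z.
  by move: hok; rewrite /box_ok/=; lia.
have := trig_forms_sound n h1 h2 h3 hc r3 w3.
rewrite /box_env; cbv zeta; case: (trig_forms _ _ _ _) => fs fc.
cbn [fst snd] => -[hs hco].
apply: encloses_cons.
  rewrite /encloses/= -/S w1 !zr0; apply: le_trans (_ : 0 <= _) => //.
  by rewrite normr_le0; apply/eqP; ring.
apply: encloses_cons.
  rewrite /encloses/= -/S w2 !zr0; apply: le_trans (_ : 0 <= _) => //.
  by rewrite normr_le0; apply/eqP; ring.
apply: encloses_cons.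
  rewrite /encloses/= -/S w3 !zr0; apply: le_trans (_ : 0 <= _) => //.
  by rewrite normr_le0; apply/eqP; ring.
apply: encloses_cons; first exact: hs.
apply: encloses_cons; first exact: hco.
elim: hcs => [|c v {}bs {}cs hv _ ih] /=; first exact: encloses_nil.
by apply: encloses_cons => //; exact: cst_form_sound.
Qed.

Definition some_pos es (env : seq R) : Prop := has (fun p => 0 < peval env p) es.

Lemma box_pos_sound n bs cs es b v1 v2 v3 : in_csts bs cs ->
  box_pos prec (mk_trig_table prec n.+1) (map cst_form bs) es b ->
  in_box b v1 v2 v3 -> some_pos es (trig_env v1 v2 v3 cs).
Proof.
move=> hcs /andP[hok hes] hb.
have [e1 [e2 [e3 [h1 h2 h3 henv]]]] := box_env_sound n hcs hok hb.
move: hes; rewrite /some_pos; elim: es => [//|p es ih] /= /orP[hp|]; last first.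
  by move=> /ih ->; rewrite orbT.
rewrite (encloses_pos prec_ge0 h1 h2 h3 _ hp) //.
exact: aff_eval_sound.
Qed.

Lemma box_sub_sound b c v1 v2 v3 : box_sub b c -> in_box b v1 v2 v3 ->
  in_box c v1 v2 v3.
Proof.
have sub b1 c1 v : itv_sub b1 c1 -> in_itv2 b1 v -> in_itv2 c1 v.
  move=> /andP[]; rewrite -!(@zr_le R) => hl hr /andP[? ?].
  by apply/andP; split; [exact: le_trans hl _|exact: le_trans hr].
by move=> /and3P[h1 h2 h3] [? ? ?]; split; [exact: sub h1 _|exact: sub h2 _|
  exact: sub h3 _].
Qed.

Lemma box_split_sound b v1 v2 v3 : in_box b v1 v2 v3 ->
  in_box (box_split b).1 v1 v2 v3 \/ in_box (box_split b).2 v1 v2 v3.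
Proof.
have split_itv c v : in_itv2 c v ->
    in_itv2 (c.1, interval_mid c) v \/ in_itv2 (interval_mid c, c.2) v.
  move=> /andP[l r]; rewrite /in_itv2/=.
  by have [h|/ltW h] := lerP (v * S) (zr (interval_mid c));
    [left|right]; rewrite ?l ?r ?h.
case: b => -[b1 b2] b3 [/= h1 h2 h3]; rewrite /box_split.
case: ifP => _; last case: ifP => _.
- by case: (split_itv _ _ h1) => ?; [left|right].
- by case: (split_itv _ _ h2) => ?; [left|right].
- by case: (split_itv _ _ h3) => ?; [left|right].
Qed.

Lemma branch_bound_sound n bs cs es excl k b v1 v2 v3 : in_csts bs cs ->
  branch_bound prec (mk_trig_table prec n.+1) (map cst_form bs) es excl k b ->
  in_box b v1 v2 v3 ->
  some_pos es (trig_env v1 v2 v3 cs) \/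
  (exists2 c, List.In c excl & in_box c v1 v2 v3).
Proof.
move=> hcs; elim: k b => [|k ih] b /=;
  (case: ifP => [hex _|_]; last case: ifP => [hpos _|_ hrec]) => hb //.
- right; elim: excl hex => [//|c ex ih] /= /orP[h|/ih[c' ? ?]].
    by exists c; [left|exact: (box_sub_sound h hb)].
  by exists c' => //; right.
- by left; exact: (box_pos_sound hcs hpos hb).
- right; elim: excl hex {ih} => [//|c ex ih] /= /orP[h|/ih[c' ? ?]].
    by exists c; [left|exact: (box_sub_sound h hb)].
  by exists c' => //; right.
- by left; exact: (box_pos_sound hcs hpos hb).
have := box_split_sound hb.
case: (box_split b) hrec => bl br /=; case: ifP => // hl hr hlr.
by case: hlr; exact: ih.
Qed.

Lemma in_scale_itv k b v : (0 <= k <= prec)%Z ->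
  in_itv2 (scale_itv prec k b) v <->
  zr b.1 <= v * zr (2 ^ k)%Z <= zr b.2.
Proof.
move=> [k0 kp]; rewrite /in_itv2 /scale_itv/= !Z.shiftl_mul_pow2; try lia.
have pE : pow2 prec = (2 ^ k * 2 ^ (prec - k))%Z.
  by rewrite pow2E // -Z.pow_add_r; first congr Z.pow; lia.
have h : 0 < (zr (2 ^ (prec - k)) : R).
  by rewrite -zr0 zr_lt; apply/Z.ltb_lt; apply: Z.pow_pos_nonneg; lia.
by rewrite /S pE !zrM mulrA !ler_pM2r.
Qed.

Lemma in_round_itv D b v : (0 < D)%Z -> zr b.1 <= v * zr D <= zr b.2 ->
  in_itv2 (round_itv prec D b) v.
Proof.
move=> D0 /andP[h1 h2]; have S0 : 0 < S := S_gt0 prec_ge0.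
have zD : 0 < (zr D : R) by rewrite -zr0 zr_lt; lia.
rewrite /in_itv2 /round_itv/= zrN; apply/andP; split.
  have [h _] := @zr_div R (pow2 prec * b.1) _ D0; apply: (le_trans h).
  by rewrite zrM -/S ler_pdivrMr // mulrAC [_ * S]mulrC ler_pM2l.
have [h _] := @zr_div R (pow2 prec * - b.2) _ D0; rewrite lerNr.
apply: (le_trans h).
rewrite zrM zrN -/S ler_pdivrMr // mulrN mulNr lerN2 mulrAC [_ * S]mulrC.
by rewrite ler_pM2l.
Qed.

End branch_bound_soundness.

(** * Enclosures of pi and of the boundary angle *)

Section constants.
Context {R : realType}.
Implicit Types t : R.

(** Decimal units, independent of the binary precision: the same enclosures feed the point checks
    with 50 bits and the box runs with 20. *)
Definition encl (v : R) (b : Z * Z) : Prop :=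
  zr b.1 <= v * zr (10 ^ 10) <= zr b.2.

Lemma encl_itv2 prec v b : (0 <= prec)%Z -> encl v b ->
  in_itv2 prec (round_itv prec (10 ^ 10) b) v.
Proof. by move=> p0; exact: in_round_itv. Qed.

Inductive encl_seq : seq (Z * Z) -> seq R -> Prop :=
  | encl_nil : encl_seq [::] [::]
  | encl_cons b v bs vs : encl v b -> encl_seq bs vs ->
      encl_seq (b :: bs) (v :: vs).

Lemma encl_seq_csts prec bs vs : (0 <= prec)%Z -> encl_seq bs vs ->
  in_csts prec (map (round_itv prec (10 ^ 10)) bs) vs.
Proof.
move=> p0; elim=> [|b v {}bs {}vs hb _ ih] /=; first exact: in_csts_nil.
by apply: in_csts_cons => //; exact: encl_itv2.
Qed.

(* Positivity at a point known up to [10 ^ -10], computed with 50 bits. *)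
Definition point_check bs b e : bool :=
  box_pos 50 (mk_trig_table 50 15)
    (map cst_form (map (round_itv 50 (10 ^ 10)) bs)) [:: e]
    ((0, 0), (0, 0), round_itv 50 (10 ^ 10) b)%Z.

Lemma point_checkP bs vs b v e : encl_seq bs vs -> encl v b ->
  point_check bs b e -> 0 < peval (trig_env 0 0 v vs) e.
Proof.
move=> hbs hb hc.
have p50 : (0 <= 50)%Z by [].
have h := @box_pos_sound R 50 p50 14 _ _ [:: e] _ 0 0 v
  (encl_seq_csts p50 hbs) hc.
have /h : in_box 50 ((0, 0), (0, 0), round_itv 50 (10 ^ 10) b)%Z 0 0 v.
  by split => /=; rewrite /in_itv2 ?mul0r ?zr0 ?lexx //; exact: encl_itv2.
by rewrite /some_pos /= orbF.
Qed.

Lemma zr_gt0 z : (0 <? z)%Z -> 0 < zr z :> R.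
Proof. by rewrite -(@zr_lt R) zr0. Qed.

Lemma encl_point z : encl (zr z / zr (10 ^ 10)) (z, z).
Proof.
have D0 : 0 < zr (10 ^ 10) :> R by apply: zr_gt0.
by rewrite /encl (divfK (lt0r_neq0 D0)) lexx.
Qed.

(** The cosine decreases on [[0, pi]] and vanishes at [pi / 2], so its signs at two neighbouring
    decimals bracket [pi / 2]. *)
Lemma pi_encl : encl pi (31415926534, 31415926536)%Z.
Proof.
have : 0 < zr (10 ^ 10) :> R by apply: zr_gt0.
have /andP[p1 p2] := @pihalf_02 R.
have hpi2 : (pi / 2 : R) \in `[0, pi]%R by rewrite in_itv/=; apply/andP; split; lra.
have h0 : (0 : R) \in `[0, pi]%R by rewrite in_itv/=; apply/andP; split; lra.
have := @point_checkP [::] [::] (15707963267, 15707963267)%Z _ (PVar 4)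
  encl_nil (encl_point _).
have -> : point_check [::] (15707963267, 15707963267)%Z (PVar 4).
  by vm_cast_no_check (erefl true).
move=> /(_ isT) /=.
have := @point_checkP [::] [::] (15707963268, 15707963268)%Z _
  (PSub (PInt 0) (PVar 4)) encl_nil (encl_point _).
have -> : point_check [::] (15707963268, 15707963268)%Z
    (PSub (PInt 0) (PVar 4)).
  by vm_cast_no_check (erefl true).
move=> /(_ isT) /=; rewrite zr0 sub0r oppr_gt0.
have : 0 <= zr 15707963267 :> R by rewrite -zr0 zr_le.
have : zr 15707963268 <= zr (2 * 10 ^ 10) :> R by rewrite zr_le.
have : zr 15707963267 <= zr 15707963268 :> R by rewrite zr_le.
rewrite /encl; cbn [fst snd].
change 31415926534%Z with (2 * 15707963267)%Z.
change 31415926536%Z with (2 * 15707963268)%Z.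
rewrite !(zrM 2) (zr_nat 2 : zr 2 = 2 :> R).
move: (zr (10 ^ 10)) (zr 15707963267) (zr 15707963268) => D x y.
move=> xy y2 x0 cy cx D0.
have pD : 2 * D <= pi * D by rewrite ler_pM2r // pi_ge2.
have hx : x / D \in `[0, (pi : R)]%R.
  rewrite in_itv/= divr_ge0 ?(ltW D0) //= ler_pdivrMr //; lra.
have hy : y / D \in `[0, (pi : R)]%R.
  rewrite in_itv/= divr_ge0 ?(ltW D0) ?(le_trans x0) //= ler_pdivrMr //; lra.
have := ltr_cos hx hpi2.
rewrite cos_pihalf.
rewrite cx => /esym; rewrite ltr_pdivrMr // => h1.
have := ltr_cos hpi2 hy; rewrite cos_pihalf cy => /esym.
rewrite ltr_pdivlMr // => h2.
by apply/andP; split; lra.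
Qed.

Definition zrE := (@zr0 R, @zr1 R,
  zr_nat 2 : zr 2 = 2 :> R,
  zr_nat 3 : zr 3 = 3 :> R,
  zr_nat 4 : zr 4 = 4 :> R,
  zr_nat 8 : zr 8 = 8 :> R,
  zr_nat 11 : zr 11 = 11 :> R,
  zr_nat 12 : zr 12 = 12 :> R,
  zr_nat 13 : zr 13 = 13 :> R,
  zr_nat 16 : zr 16 = 16 :> R,
  zr_nat 18 : zr 18 = 18 :> R,
  zr_nat 19 : zr 19 = 19 :> R,
  zr_nat 20 : zr 20 = 20 :> R,
  zr_nat 24 : zr 24 = 24 :> R,
  zr_nat 26 : zr 26 = 26 :> R,
  zr_nat 27 : zr 27 = 27 :> R,
  zr_nat 32 : zr 32 = 32 :> R,
  zr_nat 51 : zr 51 = 51 :> R,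
  zr_nat 96 : zr 96 = 96 :> R,
  zr_nat 100 : zr 100 = 100 :> R).

(* Denominators cleared: the point of the semicircle at angle [t] is equidistant
   from the centroid of the right-hand cell and from that of the upper cell. *)
Definition stationarity t : R :=
  let s := sin t in let c := cos t in
  let w := pi - 2 * t in let m := pi + 2 * t in
  (32 - 32 * c + 8 * (pi * s) - 2 * (pi * t)) * (w * w)
  + 16 * (c * (w * s - c)) * (m * m)
  + (pi - 4 * (pi * c) - 16 * s) * (m * (w * w)).

Definition stationarity_expr : pexpr :=
  (let s := #3 in let c := #4 in
  let w := #5 - 2%:I * #2 in let m := #5 + 2%:I * #2 in
  (32%:I - 32%:I * c + 8%:I * (#5 * s) - 2%:I * (#5 * #2)) * (w * w)
  + 16%:I * (c * (w * s - c)) * (m * m)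
  + (#5 - 4%:I * (#5 * c) - 16%:I * s) * (m * (w * w)))%px.

Lemma stationarityE t :
  stationarity t = peval (trig_env 0 0 t [:: pi]) stationarity_expr.
Proof. by rewrite /stationarity /= !zrE. Qed.

Lemma continuous_peval cs e :
  continuous (fun t : R => peval (trig_env 0 0 t cs) e).
Proof.
elim: e => [i|z|e1 h1 e2 h2|e1 h1 e2 h2|e1 h1 e2 h2] t /=.
- case: i => [|[|[|[|[|i]]]]] /=; first exact: cst_continuous.
  + exact: cst_continuous.
  + exact: cvg_id.
  + exact: continuous_sin.
  + exact: continuous_cos.
  + exact: cst_continuous.
- exact: cst_continuous.
- by apply: continuousD; [exact: h1|exact: h2].
- by apply: continuousB; [exact: h1|exact: h2].
- by apply: continuousM; [exact: h1|exact: h2].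
Qed.

Lemma tau_exists : exists t, stationarity t = 0 /\
  encl t (9061333690, 9061333696)%Z.
Proof.
have hpi := encl_cons pi_encl encl_nil.
have [x hx] : exists x, encl x (9061333690, 9061333690)%Z.
  by eexists; exact: encl_point.
have [y hy] : exists y, encl y (9061333696, 9061333696)%Z.
  by eexists; exact: encl_point.
have hl := @point_checkP _ _ _ _ (0%:I - stationarity_expr)%px hpi hx.
have {}hl := hl ltac:(vm_cast_no_check (erefl true)).
have hr := @point_checkP _ _ _ _ stationarity_expr hpi hy.
have {}hr := hr ltac:(vm_cast_no_check (erefl true)).
have pevalN env e : peval env (0%:I - e)%px = - peval env e :> R.
  by rewrite -sub0r -zr0.
move: hl hr; rewrite pevalN oppr_gt0 -!stationarityE => fx fy.
have : zr 9061333690 <= zr 9061333696 :> R by rewrite zr_le.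
have : 0 < zr (10 ^ 10) :> R by apply: zr_gt0.
move: hx hy; rewrite /encl; cbn [fst snd].
move: (zr 9061333690) (zr 9061333696) (zr (10 ^ 10)) => u v D.
move=> /andP[ux xu] /andP[vy yv] D0 uv.
have xy : x <= y by rewrite -(ler_pM2r D0) (le_trans xu) // (le_trans uv).
have [||t] := @IVT R stationarity _ _ 0 xy.
- apply: continuous_subspaceT => z.
  rewrite (_ : stationarity =
    fun t => peval (trig_env 0 0 t [:: pi]) stationarity_expr).
    exact: continuous_peval.
  by apply/funext => z1; rewrite stationarityE.
- by rewrite ge_min le_max (ltW fx) (ltW fy) orbT.
rewrite in_itv/= => /andP[h1 h2] ht; exists t; split => //.
apply/andP; split.
  by apply: (le_trans ux); rewrite ler_pM2r.
by apply: le_trans yv; rewrite ler_pM2r.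
Qed.

End constants.

(** * Constants of the optimal configuration *)

Section optimal_constants.
Context {R : realType}.
Implicit Types t : R.

Lemma encl_quot n d lo hi : 0 < d ->
  0 < zr (10 ^ 10) * n - zr lo * d -> 0 < zr hi * d - zr (10 ^ 10) * n ->
  encl (n / d : R) (lo, hi).
Proof.
move=> d0; rewrite /encl; cbn [fst snd]; move: (zr (10 ^ 10)) => D h1 h2.
rewrite mulrAC ler_pdivlMr // ler_pdivrMr //; apply/andP; split; lra.
Qed.

(** Expressions have no division: a quotient is enclosed by a positive denominator and two
    cross-multiplied inequalities. *)
Lemma encl_point_check bs vs b (v w : R) n d lo hi :
  encl_seq bs vs -> encl v b ->
  w = peval (trig_env 0 0 v vs) n / peval (trig_env 0 0 v vs) d ->
  [&& point_check bs b d,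
      point_check bs b ((10 ^ 10)%:I * n - lo%:I * d)%px &
      point_check bs b (hi%:I * d - (10 ^ 10)%:I * n)%px] ->
  encl w (lo, hi).
Proof.
move=> hvs hv -> /and3P[h1 h2 h3]; apply: encl_quot.
- exact: point_checkP hvs hv h1.
- exact: point_checkP hvs hv h2.
- exact: point_checkP hvs hv h3.
Qed.

(** [4 * pi] times the probability of the right-hand cell, which consists of half the diameter and
    of an arc of length [t]; [gap] is the arc length of the upper cell. *)
Definition mass t : R := pi + 2 * t.
Definition gap t : R := pi - 2 * t.
(* [1 - nu t] is the squared distance from the point of the semicircle at angle
   [t] to the centroid of the upper cell. *)
Definition nu t : R := 4 * (cos t * (gap t * sin t - cos t)) / (gap t * gap t).
Definition q0 t : R :=
  (16 - 16 * cos t + 4 * (pi * sin t) - pi * t) / (2 * mass t).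
(** [w1] and [w0] are [4 * pi] times the distortions of the right-hand and of the upper cell at
    their centroids, less [1 - nu] times the weight of their arcs. [lam] is the derivative of the
    former in the length of the interval, at length 1, with the outer end of the interval and the
    arc kept fixed. *)
Definition w1 t : R := pi / 12 + 2 * (nu t * t) - q0 t.
Definition lam t : R := pi / 4 - (pi * t / 2 - pi * q0 t) / mass t.
Definition w0 t : R := 2 * (nu t * gap t) - 8 * (cos t * cos t) / gap t.
(* Chosen so that the profile of cell costs has the value [w0] at length 0. *)
Definition ka t : R := w0 t - w1 t + lam t.

Variable t : R.
Hypothesis ht : encl t (9061333690, 9061333696)%Z.

Lemma t_bounds : 9 / 10 < t < 91 / 100.
Proof.
have := point_checkP (encl_cons pi_encl encl_nil) ht.
move=> h; have h1 := h (10%:I * #2 - 9%:I)%px ltac:(vm_cast_no_check (erefl true)).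
have h2 := h (91%:I - 100%:I * #2)%px ltac:(vm_cast_no_check (erefl true)).
move: h1 h2; rewrite /= (zr_nat 10 : zr 10 = 10 :> R) (zr_nat 9 : zr 9 = 9 :> R).
rewrite (zr_nat 91 : zr 91 = 91 :> R) (zr_nat 100 : zr 100 = 100 :> R).
by move=> *; apply/andP; split; lra.
Qed.

Lemma pi_bounds : 3141 / 1000 < (pi : R) < 3142 / 1000.
Proof.
have := point_checkP (encl_cons pi_encl encl_nil) ht.
move=> h; have h1 := h (1000%:I * #5 - 3141%:I)%px
  ltac:(vm_cast_no_check (erefl true)).
have h2 := h (3142%:I - 1000%:I * #5)%px
  ltac:(vm_cast_no_check (erefl true)).
move: h1 h2; rewrite /= (zr_nat 1000 : zr 1000 = 1000 :> R).
rewrite (zr_nat 3141 : zr 3141 = 3141 :> R) (zr_nat 3142 : zr 3142 = 3142 :> R).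
by move=> *; apply/andP; split; lra.
Qed.

Lemma mass_gt0 : 0 < mass t.
Proof. by rewrite /mass; have := t_bounds; have := pi_bounds; lra. Qed.
Lemma gap_gt0 : 0 < gap t.
Proof. by rewrite /gap; have := t_bounds; have := pi_bounds; lra. Qed.

Lemma nu_encl : encl (nu t) (5997251283, 5997251343)%Z.
Proof.
apply: (encl_point_check
  (n := (4%:I * (#4 * ((#5 - 2%:I * #2) * #3 - #4)))%px)
  (d := ((#5 - 2%:I * #2) * (#5 - 2%:I * #2))%px)
  (encl_cons pi_encl encl_nil) ht).
  have := gap_gt0; have := mass_gt0.
  rewrite /= !zrE /nu /mass /gap; move: (@pi R) => p.
  move=> /lt0r_neq0 m0 /lt0r_neq0 g0; field.
  by rewrite ?m0 ?g0.
by vm_cast_no_check (erefl true).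
Qed.

Lemma q0_encl : encl (q0 t) (13298618223, 13298618283)%Z.
Proof.
apply: (encl_point_check
  (n := (16%:I - 16%:I * #4 + 4%:I * (#5 * #3) - #5 * #2)%px)
  (d := (2%:I * (#5 + 2%:I * #2))%px)
  (encl_cons pi_encl encl_nil) ht).
  have := gap_gt0; have := mass_gt0.
  rewrite /= !zrE /q0 /mass /gap; move: (@pi R) => p.
  move=> /lt0r_neq0 m0 /lt0r_neq0 g0; field.
  by rewrite ?m0 ?g0.
by vm_cast_no_check (erefl true).
Qed.

Lemma w1_encl : encl (w1 t) (187994584, 187994824)%Z.
Proof.
apply: (encl_point_check
  (n := (#5 + 24%:I * (#6 * #2) - 12%:I * #7)%px)
  (d := (12%:I)%px)
  (encl_cons pi_encl (encl_cons nu_encl (encl_cons q0_encl encl_nil))) ht).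
  have := gap_gt0; have := mass_gt0.
  rewrite /= !zrE /w1 /mass /gap; move: (@pi R) => p.
  move=> /lt0r_neq0 m0 /lt0r_neq0 g0; field.
  by rewrite ?m0 ?g0.
by vm_cast_no_check (erefl true).
Qed.

Lemma lam_encl : encl (lam t) (13414359765, 13414359885)%Z.
Proof.
apply: (encl_point_check
  (n := (#5 * (#5 + 2%:I * #2) - 2%:I * (#5 * #2) + 4%:I * (#5 * #6))%px)
  (d := (4%:I * (#5 + 2%:I * #2))%px)
  (encl_cons pi_encl (encl_cons q0_encl encl_nil)) ht).
  have := gap_gt0; have := mass_gt0.
  rewrite /= !zrE /lam /mass /gap; move: (@pi R) => p.
  move=> /lt0r_neq0 m0 /lt0r_neq0 g0; field.
  by rewrite ?m0 ?g0.
by vm_cast_no_check (erefl true).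
Qed.

Lemma w0_encl : encl (w0 t) (-6950289958, -6950289658)%Z.
Proof.
apply: (encl_point_check
  (n := (2%:I * (#6 * ((#5 - 2%:I * #2) * (#5 - 2%:I * #2))) - 8%:I * (#4 * #4))%px)
  (d := ((#5 - 2%:I * #2))%px)
  (encl_cons pi_encl (encl_cons nu_encl encl_nil)) ht).
  have := gap_gt0; have := mass_gt0.
  rewrite /= !zrE /w0 /mass /gap; move: (@pi R) => p.
  move=> /lt0r_neq0 m0 /lt0r_neq0 g0; field.
  by rewrite ?m0 ?g0.
by vm_cast_no_check (erefl true).
Qed.

Lemma ka_encl : encl (ka t) (6276074913, 6276075713)%Z.
Proof.
apply: (encl_point_check
  (n := (#6 - #7 + #8)%px)
  (d := (1%:I)%px)
  (encl_cons pi_encl (encl_cons w0_encl (encl_cons w1_encl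
    (encl_cons lam_encl encl_nil)))) ht).
  have := gap_gt0; have := mass_gt0.
  rewrite /= !zrE /ka /mass /gap; move: (@pi R) => p.
  move=> /lt0r_neq0 m0 /lt0r_neq0 g0; field.
  by rewrite ?m0 ?g0.
by vm_cast_no_check (erefl true).
Qed.

End optimal_constants.

(** * Cell inequalities *)

Section cell_inequalities.
Context {R : realType}.
Implicit Types (t l u p a W : R).

(* A lower bound for the mass times the excess over [W] of the minimal cost of a
   cell made of an interval of length [l] centred at distance [u] from the origin
   and of an arc of length [p]. *)
Definition cell_slack t l u p W : R :=
  (pi * l + 2 * p) * (pi / 12 * l ^+ 3 + 2 * nu t * p - W)
  + 2 * pi * (l * u) * (u * p - 2 * sin p) - 8 * (1 - cos p).

(* The constant 21/100 is found by experiment: about [0.2, 0.226] would do. *)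
Definition curv t l : R := ka t + 21 / 100 * (l * (2 - l) ^+ 2).
(* A lower bound for the cost of the cell of an end point of the diameter in
   terms of its share [l] of the diameter alone; it is exact at [l = 1]. *)
Definition profile t l : R :=
  w1 t + lam t * (l - 1) + (l - 1) ^+ 2 * curv t l.
Definition mid_profile t l a : R :=
  w0 t + 2 * w1 t - profile t a - profile t (2 - l - a).

Variable t : R.
Hypothesis ht : encl t (9061333690, 9061333696)%Z.
Hypothesis st : stationarity t = 0.

(** The last two entries are listed because expressions have integer literals only. *)
Definition csts : seq R :=
  [:: pi; t; nu t; w0 t; w1 t; lam t; ka t; 21 / 100; 1 / 2].
Definition csts_itv : seq (Z * Z) :=
  [:: (31415926534, 31415926536); (9061333690, 9061333696);
      (5997251283, 5997251343); (-6950289958, -6950289658);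
      (187994584, 187994824); (13414359765, 13414359885);
      (6276074913, 6276075713); (2100000000, 2100000000);
      (5000000000, 5000000000)]%Z.

Lemma csts_encl : encl_seq csts_itv csts.
Proof.
have D0 : 0 < zr (10 ^ 10) :> R by apply: zr_gt0.
apply: (encl_cons pi_encl); apply: (encl_cons ht).
apply: (encl_cons (nu_encl ht)); apply: (encl_cons (w0_encl ht)).
apply: (encl_cons (w1_encl ht)); apply: (encl_cons (lam_encl ht)).
apply: (encl_cons (ka_encl ht)).
apply: encl_cons.
  rewrite /encl; cbn [fst snd].
  have -> : (10 ^ 10 = 100 * 10 ^ 8)%Z by [].
  have -> : (2100000000 = 21 * 10 ^ 8)%Z by [].
  rewrite !(zrM _ (10 ^ 8)) (zr_nat 100 : zr 100 = 100 :> R).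
  rewrite (zr_nat 21 : zr 21 = 21 :> R); move: (zr (10 ^ 8)) => z.
  by apply/andP; split; lra.
apply: encl_cons; last exact: encl_nil.
rewrite /encl; cbn [fst snd].
have -> : (10 ^ 10 = 2 * 5000000000)%Z by [].
rewrite zrM (zr_nat 2 : zr 2 = 2 :> R); move: (zr 5000000000) => z.
by apply/andP; split; lra.
Qed.

Definition curv_expr (l : pexpr) : pexpr :=
  (#11 + #12 * (l * ((2%:I - l) * (2%:I - l))))%px.
Definition profile_expr (l : pexpr) : pexpr :=
  (#9 + #10 * (l - 1%:I) + (l - 1%:I) * (l - 1%:I) * curv_expr l)%px.
Definition mid_profile_expr (l a : pexpr) : pexpr :=
  (#8 + 2%:I * #9 - profile_expr a - profile_expr (2%:I - l - a))%px.
Definition slack_expr (l u W : pexpr) : pexpr :=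
  ((#5 * l + 2%:I * #2)
     * (#5 * (l * (l * l)) + 12%:I * (2%:I * (#7 * #2) - W))
   + 24%:I * (#5 * (l * u) * (u * #2 - 2%:I * #3)) + 96%:I * (#4 - 1%:I))%px.

Definition end_slack_expr : pexpr :=
  slack_expr #0 (1%:I - #13 * #0)%px (profile_expr #0).
Definition mid_slack_expr : pexpr :=
  slack_expr #0 (1%:I - #13 * #0 - #1)%px (mid_profile_expr #0 #1).
(* Positive exactly when the constraint [a <= 1 - l / 2] is violated. *)
Definition violation_expr : pexpr := (#1 - (1%:I - #13 * #0))%px.
Definition origin_expr (W : pexpr) : pexpr :=
  (2%:I * (#7 * #2) - 4%:I * #2 - W)%px.

Local Notation bb_run es excl b :=
  (branch_bound 20 (mk_trig_table 20 10)
    (map cst_form (map (round_itv 20 (10 ^ 10)) csts_itv)) es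
    (map (scale_box 20 4) excl) 20 (scale_box 20 4 b)).

Definition in_box16 (b : box) (v1 v2 v3 : R) : Prop :=
  [/\ zr b.1.1.1 <= v1 * 16 <= zr b.1.1.2, zr b.1.2.1 <= v2 * 16 <= zr b.1.2.2 &
      zr b.2.1 <= v3 * 16 <= zr b.2.2].

Lemma in_box16E b v1 v2 v3 :
  in_box 20 (scale_box 20 4 b) v1 v2 v3 <-> in_box16 b v1 v2 v3.
Proof.
have k4 : (0 <= 4 <= 20)%Z by [].
have e c (v : R) : in_itv2 20 (scale_itv 20 4 c) v <->
    zr c.1 <= v * 16 <= zr c.2.
  rewrite -(zr_nat 16 : zr 16 = 16 :> R); exact: in_scale_itv.
by split=> -[/e h1 /e h2 /e h3].
Qed.

Lemma bb_runP es excl b v1 v2 v3 : bb_run es excl b ->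
  in_box16 b v1 v2 v3 ->
  some_pos es (trig_env v1 v2 v3 csts) \/
  (exists2 c, List.In c excl & in_box16 c v1 v2 v3).
Proof.
move=> hbb /in_box16E hb; have p20 : (0 <= 20)%Z by [].
have := @branch_bound_sound R 20 p20 9 _ _ es _ _ _ _ _ _
  (encl_seq_csts p20 csts_encl) hbb hb.
case=> [h|[c hc hin]]; [by left|right].
elim: excl hc {hbb} => [//|d ex ih] /= [e|/ih[c' ? ?]].
  by exists d; [left|apply/in_box16E; rewrite e].
by exists c' => //; right.
Qed.

Lemma profile_exprE v1 v2 v3 e :
  peval (trig_env v1 v2 v3 csts) (profile_expr e) =
  profile t (peval (trig_env v1 v2 v3 csts) e).
Proof.
by rewrite /profile /curv /= !zrE !expr2.
Qed.

Lemma mid_profile_exprE v1 v2 v3 el ea :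
  peval (trig_env v1 v2 v3 csts) (mid_profile_expr el ea) =
  mid_profile t (peval (trig_env v1 v2 v3 csts) el)
    (peval (trig_env v1 v2 v3 csts) ea).
Proof.
by rewrite /mid_profile /profile /curv /= !zrE !expr2.
Qed.

Lemma slack_exprE v1 v2 p el eu eW :
  peval (trig_env v1 v2 p csts) (slack_expr el eu eW) =
  12 * cell_slack t (peval (trig_env v1 v2 p csts) el)
    (peval (trig_env v1 v2 p csts) eu) p (peval (trig_env v1 v2 p csts) eW).
Proof.
rewrite /cell_slack /= !zrE.
move: (peval (trig_env v1 v2 p csts) el) (peval (trig_env v1 v2 p csts) eu).
move: (peval (trig_env v1 v2 p csts) eW) (nu t) (sin p) (cos p).
by move: (@pi R) => *; field.
Qed.

Lemma end_slack_exprE l a p : peval (trig_env l a p csts) end_slack_expr =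
  12 * cell_slack t l (1 - l / 2) p (profile t l).
Proof.
rewrite /end_slack_expr slack_exprE profile_exprE /= zrE.
by congr (_ * cell_slack _ _ _ _ _); field.
Qed.

Lemma mid_slack_exprE l a p : peval (trig_env l a p csts) mid_slack_expr =
  12 * cell_slack t l (1 - l / 2 - a) p (mid_profile t l a).
Proof.
rewrite /mid_slack_expr slack_exprE mid_profile_exprE /= zrE.
by congr (_ * cell_slack _ _ _ _ _); field.
Qed.

(* Boxes are in sixteenths. The slack vanishes at the optimal cells [(1, t)] and
   [(0, pi - 2 t)] and at the empty cell, so the excluded boxes around these
   are treated by exact expansions. *)
Lemma end_run : bb_run [:: end_slack_expr]
  [:: ((12, 20), (0, 0), (11, 18)); ((0, 2), (0, 0), (19, 26));
      ((0, 1), (0, 0), (0, 3))]%Z ((0, 32), (0, 0), (0, 51))%Z.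
Proof. by vm_cast_no_check (erefl true). Qed.

Lemma mid_run : bb_run [:: violation_expr; mid_slack_expr]
  [:: ((13, 20), (0, 1), (11, 18)); ((0, 1), (12, 16), (16, 27));
      ((0, 1), (0, 16), (0, 3))]%Z ((0, 32), (0, 16), (0, 51))%Z.
Proof. by vm_cast_no_check (erefl true). Qed.

Lemma gap_run : bb_run [:: slack_expr 0%:I 0%:I #8]
  [:: ((0, 0), (0, 0), (16, 27))]%Z ((0, 0), (0, 0), (3, 51))%Z.
Proof. by vm_cast_no_check (erefl true). Qed.

(** The expression is twelve times the excess over [1 / 4] of the coefficient of [h ^+ 2] in
    [peak_expansion]. *)
Lemma peak_run : bb_run [:: (12%:I * (#5 * (#13 * #13 * #5 - #10))
    + (#5 * #0 + 2%:I * #2)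
      * (3%:I * #5 + #5 * (#0 - 1%:I) - 12%:I * curv_expr #0)
    + 24%:I * (#13 * #13 * (#5 * ((#0 - 2%:I) * #2)) + #5 * #3) - 3%:I)%px]
  [::] ((12, 20), (0, 0), (11, 18))%Z.
Proof. by vm_cast_no_check (erefl true). Qed.

(** As [profile] has the value [w0] at 0, the slack minus [gap_slack] is divisible by [l]; the
    expression is twelve times the quotient. *)
Lemma thin_run : bb_run
  [:: (let l := #0 in let u := 1%:I - #13 * l in let p := #2 in
       12%:I * (#5 * (2%:I * (#7 * p) - profile_expr l))
       + #5 * #5 * (l * (l * l))
       + 2%:I * p * (#5 * (l * l) - 12%:I * (#10 - #11 * (2%:I - l)
          + #12 * ((1%:I - l) * (1%:I - l) * ((2%:I - l) * (2%:I - l)))))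
       + 24%:I * (#5 * u * (u * p - 2%:I * #3)))%px]
  [::] ((0, 2), (0, 0), (19, 26))%Z.
Proof. by vm_cast_no_check (erefl true). Qed.

Lemma mid_thin_run : bb_run
  [:: violation_expr;
     (let l := #0 in let z := 1%:I - #13 * l - #1 in let p := #2 in
      let m := #5 * l + 2%:I * p in
       12%:I * (#5 * (2%:I * (#7 * p) - #8)) + m * (#5 * (l * l))
       - 12%:I * (m * #10) + 24%:I * (#5 * z * (z * p - 2%:I * #3)))%px]
  [::] ((0, 1), (12, 16), (16, 27))%Z.
Proof. by vm_cast_no_check (erefl true). Qed.

Lemma mid_peak_run : bb_run
  [:: (let l := #0 in let a := #1 in let p := #2 in
      let m := #5 * l + 2%:I * p in
      m * (#12 * ((1%:I - a) * (1%:I - a) * ((2%:I - a) * (2%:I - a)))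
           - #11 * (2%:I - a))
      + 2%:I * (#5 * l * (2%:I * #3 - (2%:I - l - a) * p)))%px]
  [::] ((13, 20), (0, 1), (11, 18))%Z.
Proof. by vm_cast_no_check (erefl true). Qed.

Lemma end_origin_run : bb_run [:: origin_expr (profile_expr #0)] [::]
  ((0, 1), (0, 0), (0, 3))%Z.
Proof. by vm_cast_no_check (erefl true). Qed.

Lemma mid_origin_run :
  bb_run [:: violation_expr; origin_expr (mid_profile_expr #0 #1)] [::]
    ((0, 1), (0, 16), (0, 3))%Z.
Proof. by vm_cast_no_check (erefl true). Qed.

End cell_inequalities.

(** * Local analysis of the slack at its zeros *)

Section cell_inequality_proofs.
Context {R : realType}.
Implicit Types (l u p a W x h : R).

Lemma one_sub_cos_le x : 0 <= 1 - cos x <= x ^+ 2 / 2.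
Proof.
have := taylor_cos_bound 0 x; have := cos_le1 x.
rewrite /taylor_cos big_ord1 expr0 /= divr1 mulr1 real_normK ?num_real //.
by rewrite ler_norml (_ : 2`! = 2%N) // => ? /andP[? ?]; apply/andP; split; lra.
Qed.

Lemma sub_sin_le x k : `|x| <= k -> `|x - sin x| <= k / 6 * x ^+ 2.
Proof.
have key (y : R) : 0 <= y -> y <= k -> `|sin y - y| <= k / 6 * y ^+ 2.
  move=> y0 yk; have := taylor_sin_bound 0 y0.
  rewrite /taylor_sin big_ord1 expr0 /= divr1 mul1r expr1 => h.
  by apply: (le_trans h); rewrite (_ : 3`!%:R = 6) // [_ ^+ 3]exprS; nra.
move=> xk; have [x0|x0] := lerP 0 x.
  by rewrite distrC; apply: key => //; rewrite -(ger0_norm x0).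
have := key (- x); rewrite sinN sqrrN [- sin x - _]addrC opprK; apply.
  by rewrite oppr_ge0 ltW.
by rewrite -(ltr0_norm x0).
Qed.

Lemma sin_le_id x : 0 <= x -> sin x <= x.
Proof.
move=> x0; apply: (@le_of_derive_le R sin idfun cos (fun=> 1)) => //.
by rewrite sin0.
Qed.

Variable t : R.
Hypothesis ht : encl t (9061333690, 9061333696)%Z.
Hypothesis st : stationarity t = 0.

(** [51 / 16] is the least sixteenth above [pi], hence the upper end of the boxes. *)
Lemma le_pi_51 p : p <= pi -> p <= 51 / 16.
Proof. by have /andP[_] := pi_bounds ht; move: (@pi R) => *; lra. Qed.

Lemma gap_bounds : 132 / 100 < gap t < 135 / 100.
Proof.
rewrite /gap; have /andP[] := pi_bounds ht; have /andP[] := t_bounds ht.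
by move: (@pi R) => *; apply/andP; split; lra.
Qed.

Lemma nu_bounds : 59 / 100 < nu t < 60 / 100.
Proof.
have h := point_checkP (csts_encl ht) ht.
have h1 := h (100%:I * #7 - 59%:I)%px ltac:(vm_cast_no_check (erefl true)).
have h2 := h (60%:I - 100%:I * #7)%px ltac:(vm_cast_no_check (erefl true)).
move: h1 h2; rewrite /= zrE (zr_nat 59 : zr 59 = 59 :> R).
rewrite (zr_nat 60 : zr 60 = 60 :> R) => *.
by apply/andP; split; lra.
Qed.

Lemma cos_t_bounds : 61 / 100 < cos t < 62 / 100.
Proof.
have h := point_checkP (csts_encl ht) ht.
have h1 := h (100%:I * #4 - 61%:I)%px ltac:(vm_cast_no_check (erefl true)).
have h2 := h (62%:I - 100%:I * #4)%px ltac:(vm_cast_no_check (erefl true)).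
move: h1 h2; rewrite /= zrE (zr_nat 61 : zr 61 = 61 :> R).
rewrite (zr_nat 62 : zr 62 = 62 :> R) => *.
by apply/andP; split; lra.
Qed.

Lemma sin_t_bounds : 78 / 100 < sin t < 79 / 100.
Proof.
have h := point_checkP (csts_encl ht) ht.
have h1 := h (100%:I * #3 - 78%:I)%px ltac:(vm_cast_no_check (erefl true)).
have h2 := h (79%:I - 100%:I * #3)%px ltac:(vm_cast_no_check (erefl true)).
move: h1 h2; rewrite /= zrE (zr_nat 78 : zr 78 = 78 :> R).
rewrite (zr_nat 79 : zr 79 = 79 :> R) => *.
by apply/andP; split; lra.
Qed.

Lemma ka_gt0 : 0 < ka t.
Proof.
by have := point_checkP (csts_encl ht) ht (e := #11)
  ltac:(vm_cast_no_check (erefl true)).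
Qed.

Lemma curv_ge0 l : 0 <= l -> 0 <= curv t l.
Proof.
move=> l0; rewrite /curv addr_ge0 ?(ltW ka_gt0) //.
by apply: mulr_ge0; [lra|rewrite mulr_ge0 ?sqr_ge0].
Qed.

(* [cell_slack] at [l = 0] and [W = w0 t]; it has a double zero at [gap t]. *)
Definition gap_slack p : R :=
  2 * p * (2 * nu t * p - w0 t) - 8 * (1 - cos p).

(** The constant term cancels by the definition of [w0], the linear one by that of [nu]. *)
Lemma gap_slack_gap x :
  gap_slack (gap t + x) = 4 * nu t * x ^+ 2
    - 8 * (1 - 2 * cos t ^+ 2) * (1 - cos x)
    + 16 * (sin t * cos t) * (x - sin x).
Proof.
have cg : cos (gap t) = 1 - 2 * cos t ^+ 2.
  rewrite /gap cosB cospi sinpi mulr_natl cos_mulr2n.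
  by rewrite [cos t ^+ 2 *+ 2]mulr2n; ring.
have sg : sin (gap t) = 2 * (sin t * cos t).
  rewrite /gap sinB cospi sinpi mulr_natl sin_mulr2n.
  by rewrite [cos t * sin t *+ 2]mulr2n; ring.
have := gap_gt0 ht => /lt0r_neq0 g0.
rewrite /gap_slack cosD cg sg /w0.
have -> : nu t = 4 * (cos t * (gap t * sin t - cos t)) / (gap t * gap t) by [].
move: (gap t) g0 (sin t) (cos t) (sin x) (cos x) => g g0 s c sx cx.
by field.
Qed.

Lemma gap_slack_ge0 p : 0 <= p <= pi -> 0 <= gap_slack p.
Proof.
move=> /andP[p0 /le_pi_51 p51].
have w0E : w0 t < - 69 / 100.
  have := point_checkP (csts_encl ht) ht.
  move=> /(_ (0%:I - (100%:I * #8 + 69%:I))%px) h.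
  have := h ltac:(vm_cast_no_check (erefl true)).
  by rewrite /= !zrE (zr_nat 69 : zr 69 = 69 :> R) => *; lra.
have /andP[n1 n2] := nu_bounds.
(* Near 0 the linear term [- 2 * p * w0 t] dominates, and [1 - cos p <= p ^+ 2 / 2] suffices. *)
have [p3|p3] := lerP p (3 / 16).
  have /andP[_ c1] := one_sub_cos_le p.
  suff : 0 <= 2 * p * (2 * nu t * p - w0 t - 2 * p).
    by rewrite /gap_slack; lra.
  by rewrite mulr_ge0 ?mulr_ge0 //; nra.
have := @bb_runP R t ht _ _ _ 0 0 p gap_run.
rewrite /in_box16 /= !zrE !mul0r lexx.
case=> [|hpos|[c [<-|//]]] /=.
- by split => //; apply/andP; split; lra.
- move: hpos; rewrite /some_pos /= orbF !zrE /gap_slack.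
  by move: (pi : R) (nu t) (w0 t) (cos p) => *; lra.
rewrite !zrE => -[_ _ /andP[q1 q2]].
have -> : p = gap t + (p - gap t) by ring.
(* The excluded range [[1, 27 / 16]] lies within this distance of [gap t], and so close to the
   double zero [4 * nu t * x ^+ 2] outweighs the two other terms. *)
have : `|p - gap t| <= 38 / 100.
  by have /andP[? ?] := gap_bounds; rewrite ler_norml; apply/andP; split; lra.
move: (p - gap t) => x hx; rewrite gap_slack_gap.
have /andP[c1 c2] := one_sub_cos_le x.
have := sub_sin_le hx; rewrite ler_norml => /andP[s1 s2].
have /andP[ct1 ct2] := cos_t_bounds; have /andP[st1 st2] := sin_t_bounds.
have cg1 : 0 <= 1 - 2 * cos t ^+ 2 <= 26 / 100.
  by rewrite expr2; apply/andP; split; nra.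
have sc1 : 0 <= sin t * cos t <= 1 / 2.
  by apply/andP; split; nra.
have x2 := sqr_ge0 x.
move: cg1 sc1 c1 c2 s1 s2 x2 n1 n2.
move: (1 - 2 * _) (sin t * _) (1 - cos x) (x - sin x) (x ^+ 2) (nu t).
by move=> A B C D X n /andP[? ?] /andP[? ?] *; nra.
Qed.

(** By [sin p <= p] and [1 - cos p <= p ^+ 2 / 2] the negative terms amount to at most [4 * p] times
    [pi * l + 2 * p], which the hypothesis on [W] makes available. *)
Lemma origin_slack_ge0 l u p W : 0 <= l -> 0 <= u <= 1 -> 0 <= p <= pi ->
  0 <= 2 * nu t * p - 4 * p - W -> 0 <= cell_slack t l u p W.
Proof.
move=> l0 /andP[u0 u1] /andP[p0 ppi] hW.
have s0 : 0 <= sin p by rewrite sin_ge0_pi // p0.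
have sp := sin_le_id p0; have /andP[_ c1] := one_sub_cos_le p.
have us : u * sin p <= p.
  by apply: le_trans sp; rewrite ler_piMl.
have P0 : 0 <= (pi : R) by exact: pi_ge0.
rewrite /cell_slack; move: (@pi R) P0 (nu t) hW {ppi} => P P0 n hW.
have Pl : 0 <= P * l by rewrite mulr_ge0.
have l3 : 0 <= P / 12 * l ^+ 3 by rewrite mulr_ge0 ?exprn_ge0 //; lra.
have k1 : (P * l + 2 * p) * (4 * p) <=
    (P * l + 2 * p) * (P / 12 * l ^+ 3 + 2 * n * p - W).
  apply: ler_wpM2l; first by rewrite addr_ge0 // mulr_ge0.
  by move: l3 hW; move: (_ * l ^+ 3) (2 * n * p) => *; lra.
have k2 : P * l * (u * sin p) <= P * l * p by exact: ler_wpM2l.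
have k3 : 0 <= P * l * (u ^+ 2 * p) by rewrite mulr_ge0 ?mulr_ge0 ?sqr_ge0.
have -> : 2 * P * (l * u) * (u * p - 2 * sin p) =
  2 * (P * l * (u ^+ 2 * p)) - 4 * (P * l * (u * sin p)) by ring.
have : 0 <= p * p by rewrite mulr_ge0.
move: c1 k1 k2 k3; rewrite [p ^+ 2]expr2 mulrDl.
move: (_ * (P / 12 * _ + _ - W)) (P * l * (u ^+ 2 * p)) (P * l * (u * _)).
have -> : P * l * (4 * p) = 4 * (P * l * p) by ring.
have -> : 2 * p * (4 * p) = 8 * (p * p) by ring.
by move: (P * l * p) (p * p) (cos p) => *; lra.
Qed.

(* The terms of order at most one in [(h, x)] cancel by the choice of [w1] and
   [lam] and by [stationarity]. *)
Lemma peak_expansion h x :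
  cell_slack t (1 + h) (1 - (1 + h) / 2) (t + x) (profile t (1 + h)) =
  h ^+ 2 * (pi * (pi / 4 - lam t)
    + (pi * (1 + h) + 2 * (t + x)) * (pi / 4 + pi * h / 12 - curv t (1 + h))
    + pi / 2 * ((h - 1) * (t + x)) + 2 * pi * sin (t + x))
  + h * x * (2 * (pi / 4 - lam t) + 2 * nu t * pi - pi / 2)
  + 4 * nu t * x ^+ 2
  + (2 * pi * sin t - 8 * cos t) * (1 - cos x)
  + (2 * pi * cos t + 8 * sin t) * (x - sin x).
Proof.
have /lt0r_neq0 m0 := mass_gt0 ht; have /lt0r_neq0 g0 := gap_gt0 ht.
have e0 : mass t * q0 t - (8 - 8 * cos t + 2 * pi * sin t - pi * t / 2) = 0.
  by rewrite /q0; move: (mass t) m0 (@pi R) (sin t) (cos t) => *; field.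
have e1 : 2 * q0 t + 2 * nu t * mass t + pi / 2 - 2 * pi * cos t - 8 * sin t = 0.
  move: st; rewrite /q0 /nu /stationarity -/(mass t) -/(gap t).
  move: (mass t) m0 (gap t) g0 (@pi R) (sin t) (cos t) => m m0 g g0 P s c h0.
  transitivity (((32 - 32 * c + 8 * (P * s) - 2 * (P * t)) * (g * g)
    + 16 * (c * (g * s - c)) * (m * m)
    + (P - 4 * (P * c) - 16 * s) * (m * (g * g))) / (2 * (m * (g * g)))).
    by field; rewrite m0 g0.
  by rewrite h0 mul0r.
have e2 : pi * q0 t + mass t * (pi / 4 - lam t) - pi * t / 2 = 0.
  by rewrite /lam; move: (mass t) m0 (@pi R) (q0 t) => *; field.
apply/eqP; rewrite -subr_eq0; apply/eqP.
transitivity ((mass t * q0 t - (8 - 8 * cos t + 2 * pi * sin t - pi * t / 2))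
  + x * (2 * q0 t + 2 * nu t * mass t + pi / 2 - 2 * pi * cos t - 8 * sin t)
  + h * (pi * q0 t + mass t * (pi / 4 - lam t) - pi * t / 2)).
  rewrite /cell_slack /profile /w1 /mass sinD cosD.
  move: (curv t _) (lam t) (nu t) (q0 t) => k la n q.
  move: (@pi R) (sin t) (cos t) (sin x) (cos x) => P s c sx cx.
  by field.
by rewrite e0 e1 e2 !mulr0 !addr0.
Qed.

End cell_inequality_proofs.

(** * Nonnegativity of the slack of end and middle cells *)

Section slack_nonnegativity.
Context {R : realType}.
Implicit Types (l u p a W x h : R).

Variable t : R.
Hypothesis ht : encl t (9061333690, 9061333696)%Z.
Hypothesis st : stationarity t = 0.

Lemma peak_coeff_bounds :
  [/\ 0 <= 2 * (pi / 4 - lam t) + 2 * nu t * pi - pi / 2 <= 11 / 10,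
      - (1 / 10) <= 2 * pi * sin t - 8 * cos t <= 1 / 10 &
      0 <= 2 * pi * cos t + 8 * sin t <= 103 / 10].
Proof.
have h e := point_checkP (e := e) (csts_encl ht) ht.
have h1 := h (#7 * #5 - #10)%px ltac:(vm_cast_no_check (erefl true)).
have h2 := h (11%:I - 20%:I * (#7 * #5 - #10))%px
  ltac:(vm_cast_no_check (erefl true)).
have h3 := h (1%:I - 20%:I * (#5 * #3 - 4%:I * #4))%px
  ltac:(vm_cast_no_check (erefl true)).
have h4 := h (1%:I + 20%:I * (#5 * #3 - 4%:I * #4))%px
  ltac:(vm_cast_no_check (erefl true)).
have h5 := h (#5 * #4 + 4%:I * #3)%px ltac:(vm_cast_no_check (erefl true)).
have h6 := h (103%:I - 20%:I * (#5 * #4 + 4%:I * #3))%px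
  ltac:(vm_cast_no_check (erefl true)).
move: h1 h2 h3 h4 h5 h6; rewrite /= !zrE (zr_nat 103 : zr 103 = 103 :> R).
move: (@pi R) (nu t) (lam t) (sin t) (cos t) => P n la s c h1 h2 h3 h4 h5 h6.
by split; apply/andP; split; lra.
Qed.

Lemma peak_slack_ge0 l p : 12 / 16 <= l <= 20 / 16 -> 11 / 16 <= p <= 18 / 16 ->
  0 <= cell_slack t l (1 - l / 2) p (profile t l).
Proof.
move=> /andP[l1 l2] /andP[p1 p2].
have := @bb_runP R t ht _ _ _ l 0 p (peak_run).
rewrite /in_box16 /= !zrE !mul0r lexx.
case=> [|hA|[? []]].
  by split => //; apply/andP; split; lra.
have [h hl] : exists h, l = 1 + h by exists (l - 1); ring.
have [x hp] : exists x, p = t + x by exists (p - t); ring.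
have /andP[t1 t2] := t_bounds ht.
have hx : `|x| <= 23 / 100 by rewrite ler_norml; apply/andP; split; lra.
rewrite hl hp peak_expansion //.
have {hA} hA : 1 / 4 <= pi * (pi / 4 - lam t)
    + (pi * (1 + h) + 2 * (t + x)) * (pi / 4 + pi * h / 12 - curv t (1 + h))
    + pi / 2 * ((h - 1) * (t + x)) + 2 * pi * sin (t + x).
  move: hA; rewrite /some_pos /= orbF !zrE -hl -hp /curv expr2.
  have -> : h = l - 1 by rewrite hl; ring.
  move: (@pi R) (lam t) (ka t) (sin p) => P la k s hA.
  rewrite -subr_ge0; set A := (X in 0 <= X); set E := (X in 0 < X) in hA.
  have -> : A = E / 12 by rewrite /A /E; field.
  by rewrite divr_ge0 ?(ltW hA).
have [/andP[b1 b2] /andP[c1 c2] /andP[d1 d2]] := peak_coeff_bounds.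
have /andP[n1 _] := nu_bounds ht.
move: hA b1 b2 c1 c2 d1 d2 n1; move: (_ + 2 * pi * sin (t + x)) => A.
move: (2 * (_ - lam t) + _ - _) (2 * pi * sin t - _) (2 * pi * cos t + _).
move=> B C D; move: (nu t) => n hA b1 b2 c1 c2 d1 d2 n1.
have /andP[u1 u2] := one_sub_cos_le x.
have := sub_sin_le hx; rewrite ler_norml => /andP[v1 v2].
have x2 := sqr_ge0 x; have h2 := sqr_ge0 h.
have k1 : h ^+ 2 * (1 / 4) <= h ^+ 2 * A by exact: ler_wpM2l.
have k2 : - (1 / 20) * x ^+ 2 <= C * (1 - cos x).
  by move: u1 u2; move: (1 - cos x) => U w1 w2; nra.
have k3 : - (42 / 100) * x ^+ 2 <= D * (x - sin x).
  by move: v1 v2; move: (x - sin x) => V w1 w2; nra.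
have k4 : 236 / 100 * x ^+ 2 <= 4 * n * x ^+ 2 by apply: ler_wpM2r => //; lra.
(* The mixed term is absorbed by the square of [h / 2 - 11 / 10 * x], taken with absolute values. It
   uses up the whole [h ^+ 2 / 4], but of the coefficient of [x ^+ 2] there remains 2.36 - 0.05 -
   0.42 - 1.21 > 0. *)
have k5 : - (h ^+ 2 * (1 / 4)) - (121 / 100 * x ^+ 2) <= h * x * B.
  rewrite !expr2; have hh : `|h * x| * B <= `|h * x| * (11 / 10).
    by apply: ler_wpM2l.
  have : - (`|h * x| * B) <= h * x * B.
    by rewrite -mulNr; apply: ler_wpM2r => //; rewrite lerNl -normrN ler_norm.
  rewrite normrM in hh *; move: hh.
  rewrite -[h * h](real_normK (num_real h)) -[x * x](real_normK (num_real x)).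
  by move: (`|h|) (`|x|) => y z; have := sqr_ge0 (y / 2 - 11 / 10 * z); rewrite !expr2 => *; lra.
by lra.
Qed.

Lemma thin_slack_ge0 l p : 0 <= l <= 2 / 16 -> 19 / 16 <= p <= 26 / 16 ->
  0 <= p <= pi -> 0 <= cell_slack t l (1 - l / 2) p (profile t l).
Proof.
move=> /andP[l1 l2] /andP[p1 p2] hp; have := gap_slack_ge0 ht hp.
have := @bb_runP R t ht _ _ _ l 0 p (thin_run).
rewrite /in_box16 /= !zrE !mul0r lexx.
case=> [|hE|[? []]].
  by split => //; apply/andP; split; lra.
move: hE; rewrite /some_pos /= orbF !zrE => hE hM.
have wE : w0 t = ka t + w1 t - lam t by rewrite /ka; ring.
set E := (X in 0 < X) in hE.
have -> : cell_slack t l (1 - l / 2) p (profile t l) =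
    gap_slack t p + l * (E / 12).
  rewrite /cell_slack /gap_slack /profile /curv wE /E /profile /curv.
  move: (@pi R) (ka t) (w1 t) (lam t) (nu t) (sin p) (cos p) => *.
  by field.
by rewrite addr_ge0 // mulr_ge0 // divr_ge0 // ltW.
Qed.

Lemma end_slack_ge0 l p : 0 <= l <= 2 -> 0 <= p <= pi ->
  0 <= cell_slack t l (1 - l / 2) p (profile t l).
Proof.
move=> /andP[l0 l2] /andP[p0 ppi]; have p51 := le_pi_51 ht ppi.
have hp : 0 <= p <= pi by rewrite p0.
have := @bb_runP R t ht _ _ _ l 0 p (end_run).
rewrite /in_box16 /= !zrE !mul0r lexx.
case=> [|hpos|[c [<-|[<-|[<-|//]]]]] /=.
- by split => //; apply/andP; split; lra.
- move: hpos; rewrite /some_pos has_seq1 end_slack_exprE => h.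
  by rewrite -(@pmulr_rge0 _ 12) // ltW.
- rewrite !zrE => -[/andP[? ?] _ /andP[? ?]].
  by apply: peak_slack_ge0; apply/andP; split; lra.
- rewrite !zrE => -[/andP[? ?] _ /andP[? ?]].
  by apply: thin_slack_ge0 => //; apply/andP; split; lra.
rewrite !zrE => -[/andP[? ?] _ /andP[? ?]].
apply: origin_slack_ge0 => //; first by apply/andP; split; lra.
have := @bb_runP R t ht _ _ _ l 0 p (end_origin_run).
rewrite /in_box16 /= !zrE !mul0r lexx.
case=> [|h|[? []]]; first by split => //; apply/andP; split; lra.
move: h; rewrite /some_pos has_seq1 /origin_expr /= !zrE => h.
set E := (X in 0 < X) in h.
have -> : 2 * nu t * p - 4 * p - profile t l = E.
  by rewrite /E /profile /curv; move: (nu t) (w1 t) (lam t) (ka t) => *; ring.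
exact: ltW.
Qed.

(** The linear parts of the two profiles add up to [- (lam t * l)], and their terms with [curv] are
    nonnegative. *)
Lemma mid_profile_sub l a : 0 <= l -> 0 <= a -> l + a <= 2 ->
  - (lam t * l) <= w0 t - mid_profile t l a.
Proof.
move=> l0 a0 la; rewrite /mid_profile /profile.
have k1 : 0 <= (a - 1) ^+ 2 * curv t a by rewrite mulr_ge0 ?sqr_ge0 ?curv_ge0.
have k2 : 0 <= (2 - l - a - 1) ^+ 2 * curv t (2 - l - a).
  by rewrite mulr_ge0 ?sqr_ge0 ?curv_ge0 //; lra.
by move: k1 k2; move: (_ * curv t _) (_ * curv t a) => *; lra.
Qed.

(** Once [mid_profile] is replaced by its upper bound [w0 t + lam t * l], the slack is [gap_slack]
    plus a multiple of [l]. *)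
Lemma mid_thin_slack_ge0 l a p : 0 <= l <= 1 / 16 -> 12 / 16 <= a <= 1 ->
  a <= 1 - l / 2 -> 16 / 16 <= p <= 27 / 16 -> 0 <= p <= pi ->
  0 <= cell_slack t l (1 - l / 2 - a) p (mid_profile t l a).
Proof.
move=> /andP[l1 l2] /andP[a1 a2] la /andP[p1 p2] hp.
have := gap_slack_ge0 ht hp.
have := @bb_runP R t ht _ _ _ l a p (mid_thin_run).
rewrite /in_box16 /= !zrE.
case=> [|hE|[? []]].
  by split => //; apply/andP; split; lra.
move: hE; rewrite /some_pos /= orbF !zrE => /orP[hv|hE] hM; first lra.
set E := (X in 0 < X) in hE.
set M := pi * l + 2 * p.
have M0 : 0 <= M by rewrite addr_ge0 // mulr_ge0 ?pi_ge0 //; lra.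
have -> : cell_slack t l (1 - l / 2 - a) p (mid_profile t l a) =
    gap_slack t p + l * (E / 12)
    + M * (w0 t - mid_profile t l a - - (lam t * l)).
  rewrite /cell_slack /gap_slack /E /M.
  move: (mid_profile t l a) (w0 t) (lam t) (nu t) (sin p) (cos p) => *.
  by move: (@pi R) => *; field.
rewrite addr_ge0 //; last first.
  by rewrite mulr_ge0 // subr_ge0 mid_profile_sub //; lra.
by rewrite addr_ge0 // mulr_ge0 // divr_ge0 // ltW.
Qed.

(** At [a = 0] the interval reaches an end point of the diameter, as in an end cell, and
    [mid_profile t l 0] falls short of [profile t l] by two nonnegative terms. What [a > 0] adds is
    a multiple of [a], up to such terms. *)
Lemma mid_peak_slack_ge0 l a p : 13 / 16 <= l <= 20 / 16 -> 0 <= a <= 1 / 16 ->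
  a <= 1 - l / 2 -> 11 / 16 <= p <= 18 / 16 ->
  0 <= cell_slack t l (1 - l / 2 - a) p (mid_profile t l a).
Proof.
move=> /andP[l1 l2] /andP[a1 a2] la /andP[p1 p2].
have : 0 <= cell_slack t l (1 - l / 2) p (profile t l).
  by apply: peak_slack_ge0; apply/andP; split; lra.
have := @bb_runP R t ht _ _ _ l a p (mid_peak_run).
rewrite /in_box16 /= !zrE.
case=> [|hE|[? []]].
  by split => //; apply/andP; split; lra.
move: hE; rewrite /some_pos /= orbF !zrE => hE hL.
set E := (X in 0 < X) in hE.
set M := pi * l + 2 * p.
have M0 : 0 <= M by rewrite addr_ge0 // mulr_ge0 ?pi_ge0 //; lra.
have k1 : 0 <= (l - 1) ^+ 2 * curv t l.
  by rewrite mulr_ge0 ?sqr_ge0 ?curv_ge0 //; lra.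
have k2 : 0 <= (2 - l - a - 1) ^+ 2 * curv t (2 - l - a).
  by rewrite mulr_ge0 ?sqr_ge0 ?curv_ge0 //; lra.
have wE : w0 t = ka t + w1 t - lam t by rewrite /ka; ring.
have -> : cell_slack t l (1 - l / 2 - a) p (mid_profile t l a) =
    cell_slack t l (1 - l / 2) p (profile t l) + a * E
    + M * ((l - 1) ^+ 2 * curv t l
           + (2 - l - a - 1) ^+ 2 * curv t (2 - l - a)).
  rewrite /cell_slack /E /M /mid_profile /profile wE.
  move: (curv t l) (curv t (2 - l - a)) => kl kb; rewrite /curv.
  move: (ka t) (w1 t) (lam t) (nu t) (sin p) (cos p) => *.
  by move: (@pi R) => *; field.
rewrite addr_ge0 //; last by rewrite mulr_ge0 // addr_ge0.
by rewrite addr_ge0 // mulr_ge0 // ltW.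
Qed.

Lemma mid_slack_ge0 l a p : 0 <= l <= 2 -> 0 <= a <= 1 - l / 2 ->
  0 <= p <= pi ->
  0 <= cell_slack t l (1 - l / 2 - a) p (mid_profile t l a).
Proof.
move=> /andP[l0 l2] /andP[a0 la] hp; have /andP[p0 ppi] := hp.
have p51 := le_pi_51 ht ppi.
have := @bb_runP R t ht _ _ _ l a p (mid_run).
rewrite /in_box16 /= !zrE.
case=> [|hpos|[c [<-|[<-|[<-|//]]]]] /=.
- by split => //; apply/andP; split; lra.
- have /orP[hv|] : (0 < peval (trig_env l a p (csts t)) violation_expr) ||
      (0 < peval (trig_env l a p (csts t)) mid_slack_expr).
    by rewrite -[X in _ || X]orbF; exact: hpos.
    by move: hv; rewrite /= !zrE; lra.
  rewrite mid_slack_exprE => h.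
  by rewrite -(@pmulr_rge0 _ 12) // ltW.
- rewrite !zrE => -[/andP[? ?] /andP[? ?] /andP[? ?]].
  by apply: mid_peak_slack_ge0 => //; apply/andP; split; lra.
- rewrite !zrE => -[/andP[? ?] /andP[? ?] /andP[? ?]].
  by apply: mid_thin_slack_ge0 => //; apply/andP; split; lra.
rewrite !zrE => -[/andP[? ?] _ /andP[? ?]].
apply: origin_slack_ge0 => //; first by apply/andP; split; lra.
have := @bb_runP R t ht _ _ _ l a p (mid_origin_run).
rewrite /in_box16 /= !zrE.
case=> [|h|[? []]]; first by split => //; apply/andP; split; lra.
move: h; rewrite /some_pos [has _ _]/= orbF => /orP[hv|].
  by move: hv; rewrite /= !zrE; lra.
rewrite /origin_expr /= !zrE => h.
set E := (X in 0 < X) in h.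
have -> : 2 * nu t * p - 4 * p - mid_profile t l a = E.
  rewrite /E /mid_profile /profile /curv.
  by move: (nu t) (w0 t) (w1 t) (lam t) (ka t) => *; ring.
exact: ltW.
Qed.

End slack_nonnegativity.

(** * The cost of one cell and of three cells *)

Section cells.
Context {R : realType}.
Implicit Types (l u p a W x y z : R).

Lemma cos_le_cos_half (d m : R) : 0 <= d -> d <= m -> m <= pi - d ->
  `|cos m| <= cos d.
Proof.
move=> d0 dm mpi.
have key (k : R) : d <= k -> k <= pi -> cos k <= cos d.
  rewrite le_eqVlt => /predU1P[<- //|dk] kpi; apply: ltW.
  have hk : k \in `[0, pi]%R by rewrite in_itv/= kpi (le_trans d0) // ltW.
  have hd : d \in `[0, pi]%R by rewrite in_itv/= d0 (le_trans _ kpi) // ltW.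
  by rewrite (ltr_cos hd hk).
rewrite ler_norml; apply/andP; split; last by apply: key => //; lra.
rewrite lerNl -cosN -(cosDpi (- m)) addrC; apply: key; lra.
Qed.

(** With half-length [d] and midpoint [m] the difference is [2 * sin d * cos m]; an arc inside
    [[0, pi]] has [m] between [d] and [pi - d]. Arcs that touch an end of the semicircle give
    equality. *)
Lemma arc_moment_x (th1 th2 : R) : 0 <= th1 <= th2 -> th2 <= pi ->
  `|sin th2 - sin th1| <= sin (th2 - th1).
Proof.
move=> /andP[h0 h12] h2.
pose d := (th2 - th1) / 2; pose m := (th2 + th1) / 2.
have e2 : th2 = m + d by rewrite /m /d; field.
have e1 : th1 = m - d by rewrite /m /d; field.
have d0 : 0 <= d by rewrite /d divr_ge0 // subr_ge0.
have sd : 0 <= sin d.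
  rewrite sin_ge0_pi // d0 /d /=; have := pi_ge0 R; move: (@pi R) h2 => P *; lra.
have -> : sin th2 - sin th1 = 2 * sin d * cos m.
  by rewrite e1 e2 sinD sinB; ring.
have -> : sin (th2 - th1) = 2 * sin d * cos d.
  by rewrite (_ : th2 - th1 = d + d) ?sinD; [ring|rewrite /d; field].
rewrite normrM ger0_norm ?mulr_ge0 // ler_wpM2l ?mulr_ge0 //.
by apply: cos_le_cos_half => //; move: (@pi R) h2; rewrite /m /d => *; lra.
Qed.

(** Both sides are the squared chord, which depends on the length of the arc only. *)
Lemma arc_moment_sqr (th1 th2 : R) :
  (sin th2 - sin th1) ^+ 2 + (cos th1 - cos th2) ^+ 2 =
  2 - 2 * cos (th2 - th1).
Proof.
transitivity ((cos th1 ^+ 2 + sin th1 ^+ 2) + (cos th2 ^+ 2 + sin th2 ^+ 2)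
  - 2 * cos (th2 - th1)); first by rewrite cosB; ring.
by rewrite !cos2Dsin2; ring.
Qed.

Variable t : R.

(* [4 * pi] times the distortion, at the point [(x, y)], of a cell consisting
   of the interval of length [l] and centre [z] of the diameter and of the arc
   [th1, th2], diminished by [1 - nu t] times the mass of the arc. *)
Definition cell_cost l z th1 th2 x y : R :=
  pi * (l ^+ 3 / 12 + l * ((z - x) ^+ 2 + y ^+ 2))
  + 2 * ((nu t + x ^+ 2 + y ^+ 2) * (th2 - th1)
         - 2 * x * (sin th2 - sin th1) - 2 * y * (cos th1 - cos th2)).

(* Complete the squares in [x] and [y] after multiplication by the mass. *)
Lemma cell_cost_ge l z th1 th2 x y W : 0 <= l -> 0 <= th1 <= th2 ->
  th2 <= pi -> (l = 0 -> W <= 0) ->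
  0 <= cell_slack t l `|z| (th2 - th1) W -> W <= cell_cost l z th1 th2 x y.
Proof.
move=> l0 h1 h2 hW; have := arc_moment_x h1 h2; have := arc_moment_sqr th1 th2.
have P0 := pi_gt0 R.
have p0 : 0 <= th2 - th1 by rewrite subr_ge0; case/andP: h1.
rewrite /cell_cost /cell_slack.
move: (sin th2 - sin th1) (cos th1 - cos th2) => X Y.
move: (th2 - th1) p0 => p p0 hXY hX.
(* A cell without mass costs nothing; here the assumption on [W] at [l = 0] is what remains. *)
have [M0|M0] := eqVneq (pi * l + 2 * p) 0.
  have Pl : 0 <= pi * l by rewrite mulr_ge0 // ltW.
  have p00 : p = 0 by move: (pi * l) Pl M0 => *; lra.
  have l00 : l = 0.
    apply: (mulfI (lt0r_neq0 P0)); rewrite mulr0.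
    by move: (pi * l) M0 => ? M0; rewrite p00 in M0; lra.
  have X0 : X = 0 by apply/eqP; rewrite -normr_le0; rewrite p00 sin0 in hX.
  have Y0 : Y = 0.
    apply/eqP; rewrite -sqrf_eq0; move: hXY.
    rewrite X0 p00 cos0 expr0n/= add0r => ->; apply/eqP; ring.
  move=> _; apply: (le_trans (hW l00)).
  by rewrite l00 p00 X0 Y0 [X in 0 <= X](_ : _ = 0) //; ring.
have {}M0 : 0 < pi * l + 2 * p.
  by rewrite lt_neqAle eq_sym M0 addr_ge0 ?mulr_ge0 // ltW.
set M := pi * l + 2 * p in M0 *; move=> hs.
rewrite -(ler_pM2l M0) -subr_ge0.
(* After the squares are completed, the position of the arc survives only in [z * X], which is
   replaced by its worst value. *)
have hzX : pi * l * (z * X) <= pi * l * (`|z| * sin p).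
  apply: ler_wpM2l; first by rewrite mulr_ge0 // ltW.
  by apply: le_trans (ler_norm _) _; rewrite normrM ler_wpM2l.
have hz : z ^+ 2 = `|z| ^+ 2 by rewrite real_normK ?num_real.
have -> : M * (pi * (l ^+ 3 / 12 + l * ((z - x) ^+ 2 + y ^+ 2)) +
     2 * ((nu t + x ^+ 2 + y ^+ 2) * p - 2 * x * X - 2 * y * Y)) - M * W =
  (M * x - (pi * l * z + 2 * X)) ^+ 2 + (M * y - 2 * Y) ^+ 2
  + (M * (pi / 12 * l ^+ 3 + 2 * nu t * p - W) +
     2 * pi * (l * `|z|) * (`|z| * p - 2 * sin p) - 8 * (1 - cos p))
  + 4 * (pi * l * (`|z| * sin p) - pi * l * (z * X)).
  have hY : Y ^+ 2 = 2 - 2 * cos p - X ^+ 2 by rewrite -hXY; ring.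
  transitivity ((M * x - (pi * l * z + 2 * X)) ^+ 2 + (M * y - 2 * Y) ^+ 2
  + (M * (pi / 12 * l ^+ 3 + 2 * nu t * p - W) +
     2 * pi * l * z ^+ 2 * p - 4 * (X ^+ 2 + Y ^+ 2))
     - 4 * (pi * l * (z * X))); last by rewrite hz hY; ring.
  by rewrite /M; move: (@pi R) (nu t) => P n; field.
apply: addr_ge0; last by rewrite mulr_ge0 // subr_ge0.
by apply: addr_ge0 => //; apply: addr_ge0; exact: sqr_ge0.
Qed.

Hypothesis ht : encl t (9061333690, 9061333696)%Z.
Hypothesis st : stationarity t = 0.

Lemma w0_lt0 : w0 t < 0.
Proof.
have := point_checkP (csts_encl ht) ht (e := (0%:I - #8)%px)
  ltac:(vm_cast_no_check (erefl true)).
by rewrite /= zrE sub0r oppr_gt0.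
Qed.

Lemma profile0 : profile t 0 = w0 t.
Proof. by rewrite /profile /curv /ka; ring. Qed.

Lemma cells_cost_ge (l1 l2 l3 : R) a1 b1 a2 b2 a3 b3 x1 y1 x2 y2 x3 y3 :
  0 <= l1 -> 0 <= l2 -> 0 <= l3 -> l1 + l2 + l3 = 2 ->
  0 <= a1 <= b1 -> b1 <= pi -> 0 <= a2 <= b2 -> b2 <= pi ->
  0 <= a3 <= b3 -> b3 <= pi ->
  w0 t + 2 * w1 t <=
    cell_cost l1 (l1 / 2 - 1) a1 b1 x1 y1
    + cell_cost l2 (l1 + l2 / 2 - 1) a2 b2 x2 y2
    + cell_cost l3 (1 - l3 / 2) a3 b3 x3 y3.
Proof.
move=> l10 l20 l30 l123 hab1 hb1 hab2 hb2 hab3 hb3.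
have ps a b : 0 <= a <= b -> b <= pi -> 0 <= b - a <= pi.
  by move=> /andP[? ?]; move: (@pi R) => P ?; apply/andP; split; lra.
have k1 : profile t l1 <= cell_cost l1 (l1 / 2 - 1) a1 b1 x1 y1.
  apply: cell_cost_ge => //; first by move=> ->; rewrite profile0 ltW ?w0_lt0.
  rewrite ler0_norm ?opprB; last lra.
  by apply: end_slack_ge0 => //; [apply/andP; split; lra|exact: ps].
have k3 : profile t l3 <= cell_cost l3 (1 - l3 / 2) a3 b3 x3 y3.
  apply: cell_cost_ge => //; first by move=> ->; rewrite profile0 ltW ?w0_lt0.
  rewrite ger0_norm; last lra.
  by apply: end_slack_ge0 => //; [apply/andP; split; lra|exact: ps].
pose a := Num.min l1 l3.
have a0 : 0 <= a by rewrite /a le_min l10.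
(* The middle interval is off centre by half the difference of the end lengths, so the shorter one
   determines the distance of its centre from the origin; [mid_profile] is symmetric in the two. *)
have [hz hpr] : `|l1 + l2 / 2 - 1| = 1 - l2 / 2 - a /\
    mid_profile t l2 a = w0 t + 2 * w1 t - profile t l1 - profile t l3.
  rewrite /mid_profile /a; have [h|h] := leP l1 l3.
    rewrite ler0_norm; last lra.
    by split; [lra|have -> : 2 - l2 - l1 = l3 by lra].
  rewrite ger0_norm; last lra.
  by split; [lra|rewrite (_ : 2 - l2 - l3 = l1); [ring|lra]].
have k2 : mid_profile t l2 a <= cell_cost l2 (l1 + l2 / 2 - 1) a2 b2 x2 y2.
  have la : a <= 1 - l2 / 2.
    by rewrite /a; have [h|h] := leP l1 l3; lra.
  apply: cell_cost_ge => //.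
    move=> l2E; have := @mid_profile_sub R t ht l2 a.
    rewrite l2E mulr0 oppr0 => /(_ (lexx _) a0); rewrite subr_ge0 => h.
    by apply: (le_trans (h _)); [lra|rewrite ltW ?w0_lt0].
  rewrite hz; apply: mid_slack_ge0 => //; last exact: ps.
    by apply/andP; split; lra.
  by rewrite a0.
move: k1 k2 k3; rewrite hpr.
move: (cell_cost l1 _ _ _ _ _) (cell_cost l2 _ _ _ _ _).
by move: (cell_cost l3 _ _ _ _ _) => *; lra.
Qed.

End cells.

(** * Integrals over the diameter and the semicircle *)

Section segment_integral.
Context {R : realType}.
Implicit Types (a b c : R) (f g F : R -> R).
Local Notation mu := (@lebesgue_measure R).

Definition itg a b f : R := \int[mu]_(x in `[a, b]) f x.

Lemma continuous_itv_integrable a b f : continuous f ->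
  mu.-integrable `[a, b] (EFin \o f).
Proof.
move=> cf; apply: continuous_compact_integrable.
  exact: segment_compact.
exact: continuous_subspaceT.
Qed.

Lemma itg_EFin a b f : continuous f ->
  (\int[mu]_(x in `[a, b]) (f x)%:E)%E = (itg a b f)%:E.
Proof.
move=> cf; rewrite /itg /Rintegral fineK //.
by apply: integrable_fin_num => //; exact: continuous_itv_integrable.
Qed.

Lemma itg_le a b f g : continuous f -> continuous g ->
  (forall x, a <= x <= b -> f x <= g x) -> itg a b f <= itg a b g.
Proof.
move=> cf cg fg; apply: le_Rintegral => //; try exact: continuous_itv_integrable.
Qed.

Lemma eq_itg a b f g : (forall x, a <= x <= b -> f x = g x) ->
  itg a b f = itg a b g.
Proof.
move=> fg; apply: eq_Rintegral => x; rewrite inE/= in_itv/=; exact: fg.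
Qed.

Lemma itg_add a c b f : continuous f -> a <= c -> c <= b ->
  itg a b f = itg a c f + itg c b f.
Proof.
move=> cf ac cb; have := @Rintegral_itvB R f (BLeft a) (BRight b) c.
move=> /(_ (continuous_itv_integrable a b cf)); rewrite !bnd_simp => /(_ ac cb) h.
rewrite -[LHS](subrK (itg a c f)) addrC {2}/itg h; congr (_ + _).
rewrite Rintegral_itv_obnd_cbnd //.
apply: integrableS (continuous_itv_integrable c b cf) => //.
by move=> x /=; rewrite !in_itv/= => /andP[/ltW -> ->].
Qed.

Lemma itgB a b f g : continuous f -> continuous g ->
  itg a b (fun x => f x - g x) = itg a b f - itg a b g.
Proof.
by move=> cf cg; apply: RintegralB => //; exact: continuous_itv_integrable.
Qed.

Lemma itg_ftc a b f F : a <= b -> continuous f ->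
  (forall x : R, is_derive x 1 F (f x)) -> itg a b f = F b - F a.
Proof.
move=> + cf dF; rewrite le_eqVlt => /predU1P[<-|ab].
  by rewrite subrr /itg set_itv1 Rintegral_set1.
have cF : continuous F.
  by move=> x; apply: differentiable_continuous; apply/derivable1_diffP; case: (dF x).
rewrite /itg /Rintegral (@continuous_FTC2 R f F) //.
- exact: continuous_subspaceT.
- split.
  + by move=> x _; case: (dF x).
  + by apply: cvg_at_right_filter; exact: cF.
  + by apply: cvg_at_left_filter; exact: cF.
- by move=> x _; rewrite derive1E; case: (dF x) => _ ->.
Qed.

End segment_integral.

(** * Intervals of the diameter and arcs of the semicircle *)

Section nearest_of_three.
Context {R : realType}.
Implicit Types (a b c x y : R) (f g : R -> R) (p q : R * R).

(** Cells and arcs are delimited by inequalities on open intervals; this spares a study of their end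
    points, which have measure zero. *)
Lemma itg_le_oo a b f g : continuous f -> continuous g ->
  (forall x, a < x < b -> f x <= g x) -> itg a b f <= itg a b g.
Proof.
move=> cf cg fg; rewrite -lee_fin -!itg_EFin //.
have itoo (h : R -> R) : continuous h ->
    (\int[lebesgue_measure]_(x in `[a, b]) (h x)%:E)%E =
    (\int[lebesgue_measure]_(x in `]a, b[) (h x)%:E)%E.
  move=> ch; apply: (@integral_itv_bndoo R a b (EFin \o h) true false).
  apply/measurable_EFinP; apply: measurable_funTS.
  exact: continuous_measurable_fun.
have ioo (h : R -> R) : continuous h ->
    (@lebesgue_measure R).-integrable `]a, b[ (EFin \o h).
  move=> ch; apply: integrableS (continuous_itv_integrable a b ch) => //.
  exact: subset_itv_oo_cc.
rewrite !itoo //; apply: le_integral => //; try exact: ioo.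
by move=> x; rewrite inE/= in_itv/= lee_fin; exact: fg.
Qed.

Lemma itg_cst a b c : a <= b -> itg a b (fun=> c) = c * (b - a).
Proof.
move=> ab; transitivity (c * b - c * a); last by ring.
apply: (itg_ftc (F := fun x => c * x)) => //; first exact: cst_continuous.
move=> x; have := is_deriveZ c (is_derive_id (x : R) 1).
by rewrite /GRing.scale/= mulr1.
Qed.

(** Convertible to [diameter_param], but with domain [R] itself, where the calculus takes place;
    similarly for [on_semicircle]. *)
Definition on_diameter (x : R) : R * R := (x, 0).
Definition on_semicircle (x : R) : R * R := (cos x, sin x).

Lemma continuous_sqr_sub (h : R -> R) c : continuous h ->
  continuous (fun x => (h x - c) ^+ 2).
Proof.
move=> ch x.
apply: (@continuous_comp _ _ _ (fun z : R => h z - c) (fun z : R => z ^+ 2)).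
  by apply: continuousB; [exact: ch|exact: cst_continuous].
exact: exprn_continuous.
Qed.

Lemma continuous_sqdist_diameter p :
  continuous (fun x => sqdist (on_diameter x) p).
Proof.
move=> x; apply: (@continuousD _ _ _ (fun z : R => (z - p.1) ^+ 2)
  (fun=> (0 - p.2) ^+ 2)); last exact: cst_continuous.
by apply: (@continuous_sqr_sub id) => y; exact: cvg_id.
Qed.

Lemma continuous_sqdist_semicircle p :
  continuous (fun x => sqdist (on_semicircle x) p).
Proof.
move=> x; apply: (@continuousD _ _ _ (fun z : R => (cos z - p.1) ^+ 2)
  (fun z : R => (sin z - p.2) ^+ 2)).
  by apply: continuous_sqr_sub; exact: continuous_cos.
by apply: continuous_sqr_sub; exact: continuous_sin.
Qed.

Lemma itg_sqdist_diameter p a b : a <= b ->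
  itg a b (fun x => sqdist (on_diameter x) p) =
  (b - a) ^+ 3 / 12 + (b - a) * (((a + b) / 2 - p.1) ^+ 2 + p.2 ^+ 2).
Proof.
move=> ab; pose F x := 2 / 3`!%:R * x ^+ 3 + (- 2 * p.1) / 2`!%:R * x ^+ 2
   + (p.1 ^+ 2 + p.2 ^+ 2) / 1`!%:R * x ^+ 1.
have f3 : 3`!%:R = 6 :> R by [].
have f2 : 2`!%:R = 2 :> R by [].
have f1 : 1`!%:R = 1 :> R by [].
transitivity (F b - F a); last by rewrite /F f3 f2 f1; field.
apply: itg_ftc => //; first exact: continuous_sqdist_diameter.
move=> x; have h3 := is_derive_mono 2 2 x.
have h2 := is_derive_mono 1 (- 2 * p.1) x.
have h1 := is_derive_mono 0 (p.1 ^+ 2 + p.2 ^+ 2) x.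
have -> : sqdist (on_diameter x) p = 2 / 2`!%:R * x ^+ 2
    + - 2 * p.1 / 1`!%:R * x ^+ 1 + (p.1 ^+ 2 + p.2 ^+ 2) / 1`!%:R * x ^+ 0.
  by rewrite f2 f1 /sqdist /on_diameter; cbn [fst snd]; field.
exact: is_deriveD (is_deriveD h3 h2) h1.
Qed.

Lemma itg_sqdist_semicircle p k a b : a <= b ->
  itg a b (fun x => sqdist (on_semicircle x) p - k) =
  (1 - k + p.1 ^+ 2 + p.2 ^+ 2) * (b - a) - 2 * p.1 * (sin b - sin a)
  - 2 * p.2 * (cos a - cos b).
Proof.
move=> ab; pose K := 1 - k + p.1 ^+ 2 + p.2 ^+ 2.
pose F x := K * x + (- 2 * p.1) * sin x + (2 * p.2) * cos x.
transitivity (F b - F a).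
  apply: itg_ftc => //.
    move=> x; apply: (@continuousB _ _ _
      (fun z => sqdist (on_semicircle z) p) (fun=> k)).
      exact: continuous_sqdist_semicircle.
    exact: cst_continuous.
  move=> x; have := is_deriveD (is_deriveD (is_deriveZ K (is_derive_id (x : R) 1))
   (is_deriveZ (- 2 * p.1) (is_derive_sin x))) (is_deriveZ (2 * p.2) (is_derive_cos x)).
  rewrite (_ : _ + _ = F) //; congr (is_derive _ _ _ _).
  rewrite /sqdist /on_semicircle /GRing.scale/= /K.
  transitivity (1 - k + p.1 ^+ 2 + p.2 ^+ 2 - 2 * p.1 * cos x - 2 * p.2 * sin x).
    by ring.
  by rewrite -{1}(cos2Dsin2 x); ring.
by rewrite /F /K; ring.
Qed.

(** [c] is [A / B] clamped to [[lo, hi]]; testing the end points first disposes of [B = 0]. *)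
Lemma affine_crossing (A B lo hi : R) : 0 <= B -> lo <= hi ->
  exists c, [/\ lo <= c <= hi,
    forall x, lo < x < c -> B * x <= A & forall x, c < x < hi -> A <= B * x].
Proof.
move=> B0 lohi; have [h|h] := leP (B * hi) A.
  exists hi; split; first by rewrite lohi lexx.
    move=> x /andP[_ /ltW xh]; apply: le_trans h; exact: ler_wpM2l.
  by move=> x /andP[h1 h2]; move: (lt_trans h1 h2); rewrite ltxx.
have [k|k] := leP A (B * lo).
  exists lo; split; first by rewrite lohi lexx.
    by move=> x /andP[h1 h2]; move: (lt_trans h1 h2); rewrite ltxx.
  by move=> x /andP[/ltW xh _]; apply: (le_trans k); exact: ler_wpM2l.
have {}B0 : 0 < B.
  rewrite lt_neqAle B0 andbT; apply/eqP => B1.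
  by move: (lt_trans k h); rewrite -B1 !mul0r ltxx.
exists (A / B); split.
- by rewrite ler_pdivlMr // ler_pdivrMr // mulrC (ltW k) mulrC ltW.
- by move=> x /andP[_ /ltW]; rewrite ler_pdivlMr // mulrC.
- by move=> x /andP[/ltW + _]; rewrite ler_pdivrMr // mulrC.
Qed.

Lemma sqdist_diameter_le p q x :
  (sqdist (on_diameter x) p <= sqdist (on_diameter x) q) =
  (2 * (q.1 - p.1) * x <= q.1 ^+ 2 + q.2 ^+ 2 - p.1 ^+ 2 - p.2 ^+ 2).
Proof.
rewrite -subr_ge0 -[RHS]subr_ge0 /sqdist /on_diameter/=.
by congr (0 <= _); ring.
Qed.

Definition nearest p1 p2 p3 (z : R * R) : R :=
  Num.min (sqdist z p1) (Num.min (sqdist z p2) (sqdist z p3)).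

Lemma diameter_cells p1 p2 p3 : p1.1 <= p2.1 -> p2.1 <= p3.1 ->
  exists b1 b2, [/\ -1 <= b1, b1 <= b2, b2 <= 1 & [/\
    forall x, -1 < x < b1 ->
      sqdist (on_diameter x) p1 <= nearest p1 p2 p3 (on_diameter x),
    forall x, b1 < x < b2 ->
      sqdist (on_diameter x) p2 <= nearest p1 p2 p3 (on_diameter x) &
    forall x, b2 < x < 1 ->
      sqdist (on_diameter x) p3 <= nearest p1 p2 p3 (on_diameter x)]].
Proof.
move=> h12 h23.
have cross p q lo hi : p.1 <= q.1 -> lo <= hi -> exists c, [/\ lo <= c <= hi,
    forall x, lo < x < c -> sqdist (on_diameter x) p <= sqdist (on_diameter x) q &
    forall x, c < x < hi -> sqdist (on_diameter x) q <= sqdist (on_diameter x) p].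
  move=> pq lohi; have := @affine_crossing
    (q.1 ^+ 2 + q.2 ^+ 2 - p.1 ^+ 2 - p.2 ^+ 2) (2 * (q.1 - p.1)) lo hi.
  case=> [|//|c [hc hl hr]]; first by rewrite mulr_ge0 // subr_ge0.
  exists c; split => // x hx; first by rewrite sqdist_diameter_le hl.
  by have := hr _ hx; rewrite sqdist_diameter_le; lra.
have le11 : (-1 : R) <= 1 by lra.
have [c13 [/andP[l13 u13] hl13 hr13]] := cross _ _ _ _ (le_trans h12 h23) le11.
have [c23 [/andP[l23 u23] hl23 hr23]] := cross _ _ _ _ h23 le11.
(* Beyond [b2] the third centre beats both others, and before it at least one of them beats the
   third; hence only the first two compete on [[-1, b2]]. *)
pose b2 := Num.max c13 c23.
have lb2 : -1 <= b2 by rewrite /b2 le_max l13.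
have ub2 : b2 <= 1 by rewrite /b2 ge_max u13.
have [b1 [/andP[l1 u1] hl hr]] := cross _ _ _ _ h12 lb2.
have mid x : -1 < x < b2 -> sqdist (on_diameter x) p1 <= sqdist (on_diameter x) p3 \/
    sqdist (on_diameter x) p2 <= sqdist (on_diameter x) p3.
  move=> /andP[x1]; rewrite /b2 lt_max => /orP[h|h].
    by left; apply: hl13; rewrite x1.
  by right; apply: hl23; rewrite x1.
exists b1, b2; split => //; split => x /andP[x1 x2]; rewrite /nearest !le_min lexx /=.
- have h := hl x; rewrite x1 x2 in h; have {}h := h isT; rewrite h /=.
  have hx : -1 < x < b2 by rewrite x1 (lt_le_trans x2).
  by case: (mid x hx) => // h3; exact: le_trans h h3.
- have h := hr x; rewrite x1 x2 in h; have {}h := h isT; rewrite h /=.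
  have hx : -1 < x < b2 by rewrite x2 andbT (le_lt_trans l1).
  by case: (mid x hx) => // h3; exact: le_trans h h3.
- move: x1; rewrite /b2 gt_max => /andP[y1 y2].
  by rewrite hr13 ?hr23 ?y1 ?y2.
Qed.

(** The unit vector at [th] is a combination of those at [a] and [b] with nonnegative coefficients
    [sin (b - th)] and [sin (th - a)] over [sin (b - a)], whose sum is at least 1; as [k > 0], this
    suffices. The case [b - a = pi], where the denominator vanishes, is excluded because [x] and
    [- x] cannot both be at least [k]. *)
Lemma harmonic_superlevel (x y k a b th : R) : 0 < k ->
  0 <= a -> b <= pi -> a < th < b ->
  k <= x * cos a + y * sin a -> k <= x * cos b + y * sin b ->
  k <= x * cos th + y * sin th.
Proof.
move=> k0 a0 bpi /andP[ath thb] ga gb.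
have sab : 0 < sin (b - a).
  apply: sin_gt0_pi; rewrite subr_gt0 (lt_trans ath) //=.
  rewrite lt_neqAle lerBlDr (le_trans bpi) ?lerDl // andbT.
  apply/eqP => hba; have aE : a = 0 by move: (@pi R) bpi hba => *; lra.
  have bE : b = pi by rewrite -hba aE subr0.
  by move: ga gb; rewrite aE bE cos0 sin0 cospi sinpi; lra.
have u0 : 0 <= sin (b - th).
  by apply: sin_ge0_pi; apply/andP; split; [|move: (@pi R) bpi => *]; lra.
have v0 : 0 <= sin (th - a).
  by apply: sin_ge0_pi; apply/andP; split; [|move: (@pi R) bpi => *]; lra.
have uv : sin (b - a) <= sin (b - th) + sin (th - a).
  rewrite (_ : b - a = (b - th) + (th - a)); last ring.
  rewrite sinD [cos _ * _]mulrC; apply: lerD; apply: ler_piMr => //; exact: cos_le1.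
rewrite -(ler_pM2l sab).
have -> : sin (b - a) * (x * cos th + y * sin th) =
  sin (b - th) * (x * cos a + y * sin a) + sin (th - a) * (x * cos b + y * sin b).
  by rewrite !sinB; ring.
have k1 : sin (b - th) * k <= sin (b - th) * (x * cos a + y * sin a) by exact: ler_wpM2l.
have k2 : sin (th - a) * k <= sin (th - a) * (x * cos b + y * sin b) by exact: ler_wpM2l.
apply: le_trans (lerD k1 k2); rewrite -mulrDl ler_pM2r //.
Qed.

Lemma harmonic_interval (x y k : R) : 0 < k -> exists a b : R,
  [/\ 0 <= a, a <= b, b <= pi & [/\
    forall th, a < th < b -> k <= x * cos th + y * sin th,
    forall th, 0 < th < a -> x * cos th + y * sin th <= k &
    forall th, b < th < pi -> x * cos th + y * sin th <= k]].
Proof.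
move=> k0; pose A := [set th | (0 <= th <= pi) && (k <= x * cos th + y * sin th)].
have [Aex|/forallNP A0] := pselect (exists th, A th); last first.
  exists 0, 0; split; rewrite ?pi_ge0 //; split => th /andP[h1 h2].
  - by move: (lt_trans h1 h2); rewrite ltxx.
  - by move: (lt_trans h1 h2); rewrite ltxx.
  rewrite leNgt; apply/negP => /ltW h; apply: (A0 th).
  by rewrite /A/= h andbT !ltW.
have Ai : has_inf A by split => //; exists 0 => z /andP[/andP[]].
have As : has_sup A by split => //; exists pi => z /andP[/andP[]].
have il z : A z -> inf A <= z by move=> Az; apply: ge_inf => //; case: Ai.
have su z : A z -> z <= sup A by move=> Az; apply: sup_ubound => //; case: As.
have [z Az] := Aex.
exists (inf A), (sup A); split.
- by apply: lb_le_inf; [exists z|move=> w /andP[/andP[]]].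
- exact: le_trans (il _ Az) (su _ Az).
- by apply: ge_sup; [exists z|move=> w /andP[/andP[]]].
split => th /andP[h1 h2].
- have [u /andP[/andP[u0 upi] gu] uth] := inf_lt Aex h1.
  have [v /andP[/andP[v0 vpi] gv] thv] := sup_gt Aex h2.
  by apply: (@harmonic_superlevel x y k u v th) => //; rewrite uth thv.
- rewrite leNgt; apply/negP => /ltW h.
  have : A th.
    rewrite /A/= h andbT ltW //= ltW // (lt_le_trans h2) // (le_trans (il _ Az)) //.
    by case/andP: Az => /andP[].
  by move=> /il; rewrite leNgt h2.
- rewrite leNgt; apply/negP => /ltW h.
  have : A th.
    rewrite /A/= h andbT [th <= pi]ltW // andbT ltW //.
    apply: le_lt_trans h1; apply: le_trans (su _ Az).
    by case/andP: Az => /andP[].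
  by move=> /su; rewrite leNgt h1.
Qed.

End nearest_of_three.

(** * Lower bound for the distortion of three centres *)

Section distortion_lower_bound.
Context {R : realType}.
Implicit Types (a b c x y r : R) (p q : R * R).

Lemma continuous_minr (f g : R -> R) : continuous f -> continuous g ->
  continuous (fun x => Num.min (f x) (g x)).
Proof. by move=> cf cg x; apply: continuous_min; [exact: cf|exact: cg]. Qed.

Lemma continuous_maxr (f g : R -> R) : continuous f -> continuous g ->
  continuous (fun x => Num.max (f x) (g x)).
Proof. by move=> cf cg x; apply: continuous_max; [exact: cf|exact: cg]. Qed.

Lemma continuous_subr (f g : R -> R) : continuous f -> continuous g ->
  continuous (fun x => f x - g x).
Proof. by move=> cf cg x; apply: (@continuousB _ _ _ f g); [exact: cf|exact: cg]. Qed.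

Lemma continuous_constr c : continuous (fun _ : R => c).
Proof. by move=> x; exact: cst_continuous. Qed.

Lemma continuous_nearest_diameter p1 p2 p3 :
  continuous (fun x => nearest p1 p2 p3 (on_diameter x)).
Proof.
by apply: continuous_minr; [|apply: continuous_minr];
  exact: continuous_sqdist_diameter.
Qed.

Lemma continuous_nearest_semicircle p1 p2 p3 :
  continuous (fun x => nearest p1 p2 p3 (on_semicircle x)).
Proof.
by apply: continuous_minr; [|apply: continuous_minr];
  exact: continuous_sqdist_semicircle.
Qed.

Lemma positive_part_arc p r : r < 1 -> exists a b,
  [/\ 0 <= a <= b, b <= pi &
   itg 0 pi (fun x => Num.max (r - sqdist (on_semicircle x) p) 0) <=
   - itg a b (fun x => sqdist (on_semicircle x) p - r)].
Proof.
move=> r1; pose k := (1 - r + p.1 ^+ 2 + p.2 ^+ 2) / 2.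
have k0 : 0 < k.
  rewrite /k divr_gt0 // -addrA ltr_wpDr ?addr_ge0 ?sqr_ge0 //; lra.
have E x : r - sqdist (on_semicircle x) p = 2 * (p.1 * cos x + p.2 * sin x - k).
  rewrite /k /sqdist /on_semicircle/=.
  have -> : (cos x - p.1) ^+ 2 + (sin x - p.2) ^+ 2 = (cos x ^+ 2 + sin x ^+ 2)
    - 2 * (p.1 * cos x + p.2 * sin x) + p.1 ^+ 2 + p.2 ^+ 2 by ring.
  by rewrite cos2Dsin2; field.
have [a [b [a0 ab bpi [hm hl hr]]]] := harmonic_interval p.1 p.2 k0.
exists a, b; split; rewrite ?a0 //.
have cs : continuous (fun x => sqdist (on_semicircle x) p - r).
  by apply: continuous_subr; [exact: continuous_sqdist_semicircle|exact: continuous_constr].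
have cp : continuous (fun x => r - sqdist (on_semicircle x) p).
  by apply: continuous_subr; [exact: continuous_constr|exact: continuous_sqdist_semicircle].
have cm : continuous (fun x => Num.max (r - sqdist (on_semicircle x) p) 0).
  by apply: continuous_maxr => //; exact: continuous_constr.
rewrite (itg_add cm a0 (le_trans ab bpi)) (itg_add cm ab bpi).
have zero lo hi : lo <= hi -> (forall x, lo < x < hi -> r - sqdist (on_semicircle x) p <= 0) ->
    itg lo hi (fun x => Num.max (r - sqdist (on_semicircle x) p) 0) <= 0.
  move=> lohi h; rewrite -[leRHS](@mul0r _ (hi - lo)) -itg_cst //.
  apply: itg_le_oo => //; first exact: continuous_constr.
  by move=> x hx; rewrite ge_max h // lexx.
have h1 : itg 0 a (fun x => Num.max (r - sqdist (on_semicircle x) p) 0) <= 0.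
  by apply: zero => // x hx; rewrite E; have := hl x hx; lra.
have h3 : itg b pi (fun x => Num.max (r - sqdist (on_semicircle x) p) 0) <= 0.
  by apply: zero => // x hx; rewrite E; have := hr x hx; lra.
have h2 : itg a b (fun x => Num.max (r - sqdist (on_semicircle x) p) 0) <=
    itg a b (fun x => r - sqdist (on_semicircle x) p).
  apply: itg_le_oo => // x hx; rewrite ge_max lexx /= E.
  by have := hm x hx; lra.
have e : itg a b (fun x => r - sqdist (on_semicircle x) p) =
    - itg a b (fun x => sqdist (on_semicircle x) p - r).
  rewrite -[RHS]add0r -[X in X - _](@mul0r _ (b - a)) -itg_cst //.
  rewrite -itgB //; last exact: continuous_constr.
  by apply: eq_itg => x _; ring.
by move: h1 h2 h3; rewrite e; lra.
Qed.

Variable t : R.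
Hypothesis ht : encl t (9061333690, 9061333696)%Z.
Hypothesis st : stationarity t = 0.

Lemma cell_costE p a b (c d : R) : a <= b -> c <= d ->
  cell_cost t (d - c) ((c + d) / 2) a b p.1 p.2 =
  pi * itg c d (fun x => sqdist (on_diameter x) p)
  + 2 * itg a b (fun x => sqdist (on_semicircle x) p - (1 - nu t)).
Proof.
move=> ab cd; rewrite itg_sqdist_diameter // itg_sqdist_semicircle //.
by rewrite /cell_cost; congr (_ * _ + 2 * _); ring.
Qed.

Lemma nearest_sorted_ge p1 p2 p3 : p1.1 <= p2.1 -> p2.1 <= p3.1 ->
  2 * pi * (1 - nu t) + w0 t + 2 * w1 t <=
  pi * itg (-1) 1 (fun x => nearest p1 p2 p3 (on_diameter x)) +
  2 * itg 0 pi (fun x => nearest p1 p2 p3 (on_semicircle x)).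
Proof.
move=> h12 h23.
have [c1 [c2 [hc1 hc12 hc2 [d1 d2 d3]]]] := diameter_cells h12 h23.
have cd : continuous (fun x => nearest p1 p2 p3 (on_diameter x)).
  exact: continuous_nearest_diameter.
have cs : continuous (fun x => nearest p1 p2 p3 (on_semicircle x)).
  exact: continuous_nearest_semicircle.
have /andP[n1 n2] := nu_bounds ht.
pose r := 1 - nu t.
have r1 : r < 1 by rewrite /r; lra.
have [a1 [b1 [ab1 bpi1 k1]]] := positive_part_arc p1 r1.
have [a2 [b2 [ab2 bpi2 k2]]] := positive_part_arc p2 r1.
have [a3 [b3 [ab3 bpi3 k3]]] := positive_part_arc p3 r1.
pose g p x := Num.max (r - sqdist (on_semicircle x) p) 0.
have cg p : continuous (g p).
  apply: continuous_maxr; last exact: continuous_constr.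
  by apply: continuous_subr; [exact: continuous_constr|exact: continuous_sqdist_semicircle].
(* Weak duality: [min f_i >= r - \sum (r - f_i)^+]. *)
have arcs : r * pi - itg 0 pi (g p1) - itg 0 pi (g p2) - itg 0 pi (g p3) <=
    itg 0 pi (fun x => nearest p1 p2 p3 (on_semicircle x)).
  have -> : r * pi = itg 0 pi (fun=> r) by rewrite itg_cst ?pi_ge0 // subr0.
  rewrite -!itgB //; first last.
  - exact: continuous_constr.
  - by apply: continuous_subr => //; exact: continuous_constr.
  - apply: continuous_subr => //; apply: continuous_subr => //; exact: continuous_constr.
  apply: itg_le => //.
    by do 3 (apply: continuous_subr => //); exact: continuous_constr.
  have g0 q x : 0 <= g q x by rewrite /g le_max lexx orbT.
  have gr q x : r - sqdist (on_semicircle x) q <= g q x by rewrite /g le_max lexx.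
  move=> x _; rewrite /nearest !le_min; apply/and3P; split.
  - have := gr p1 x; have := g0 p2 x; have := g0 p3 x; lra.
  - have := gr p2 x; have := g0 p1 x; have := g0 p3 x; lra.
  - have := gr p3 x; have := g0 p2 x; have := g0 p1 x; lra.
have diam : itg (-1) c1 (fun x => sqdist (on_diameter x) p1) +
    itg c1 c2 (fun x => sqdist (on_diameter x) p2) +
    itg c2 1 (fun x => sqdist (on_diameter x) p3) <=
    itg (-1) 1 (fun x => nearest p1 p2 p3 (on_diameter x)).
  rewrite (itg_add cd hc1 (le_trans hc12 hc2)) (itg_add cd hc12 hc2) addrA.
  by apply: lerD; [apply: lerD|]; apply: itg_le_oo => //;
    exact: continuous_sqdist_diameter.
have := @cells_cost_ge R t ht st (c1 - -1) (c2 - c1) (1 - c2) a1 b1 a2 b2 a3 b3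
  p1.1 p1.2 p2.1 p2.2 p3.1 p3.2.
rewrite ab1 bpi1 ab2 bpi2 ab3 bpi3 !subr_ge0 hc1 hc12 hc2.
have e4 : c1 - -1 + (c2 - c1) + (1 - c2) = 2 by ring.
move=> /(_ isT isT isT e4 isT isT isT isT isT isT).
have -> : (c1 - -1) / 2 - 1 = (-1 + c1) / 2 by field.
have -> : c1 - -1 + (c2 - c1) / 2 - 1 = (c1 + c2) / 2 by field.
have -> : 1 - (1 - c2) / 2 = (c2 + 1) / 2 by field.
have /andP[_ ab1'] := ab1; have /andP[_ ab2'] := ab2; have /andP[_ ab3'] := ab3.
rewrite !cell_costE //.
have hD := ler_wpM2l (pi_ge0 R) diam; rewrite !mulrDr in hD; move: hD.
move: k1 k2 k3 arcs; rewrite -/r -/(g p1) -/(g p2) -/(g p3).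
move: (itg 0 pi (g p1)) (itg 0 pi (g p2)) (itg 0 pi (g p3)) => G1 G2 G3.
move: (itg a1 b1 _) (itg a2 b2 _) (itg a3 b3 _) => A1 A2 A3.
move: (pi * itg (-1) c1 _) (pi * itg c1 c2 _) (pi * itg c2 1 _) => D1 D2 D3.
move: (pi * itg _ _ _) (itg 0 pi _) => D S.
have -> : 2 * pi * r = 2 * (r * pi) by ring.
by move: (r * pi) (w0 t) (w1 t) => *; lra.
Qed.

Lemma nearest_ge p1 p2 p3 :
  2 * pi * (1 - nu t) + w0 t + 2 * w1 t <=
  pi * itg (-1) 1 (fun x => nearest p1 p2 p3 (on_diameter x)) +
  2 * itg 0 pi (fun x => nearest p1 p2 p3 (on_semicircle x)).
Proof.
have swap12 q1 q2 q3 : nearest q1 q2 q3 = nearest q2 q1 q3.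
  by apply/funext => z; rewrite /nearest minCA.
have swap23 q1 q2 q3 : nearest q1 q2 q3 = nearest q1 q3 q2.
  by apply/funext => z; rewrite /nearest [Num.min (sqdist z q2) _]minC.
pose bound q1 q2 q3 := 2 * pi * (1 - nu t) + w0 t + 2 * w1 t <=
  pi * itg (-1) 1 (fun x => nearest q1 q2 q3 (on_diameter x)) +
  2 * itg 0 pi (fun x => nearest q1 q2 q3 (on_semicircle x)).
have b12 q1 q2 q3 : bound q1 q2 q3 -> bound q2 q1 q3.
  by rewrite /bound (swap12 q1).
have b23 q1 q2 q3 : bound q1 q2 q3 -> bound q1 q3 q2.
  by rewrite /bound (swap23 q1).
have sorted q1 q2 q3 : q1.1 <= q2.1 -> q2.1 <= q3.1 -> bound q1 q2 q3.
  exact: nearest_sorted_ge.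
rewrite -/(bound p1 p2 p3).
have [h12|/ltW h12] := leP p1.1 p2.1; have [h23|/ltW h23] := leP p2.1 p3.1;
  have [h13|/ltW h13] := leP p1.1 p3.1.
- exact: sorted.
- exact: sorted.
- by apply: b23; exact: sorted.
- by apply: b23; apply: b12; exact: sorted.
- by apply: b12; exact: sorted.
- by apply: b12; apply: b23; exact: sorted.
- exact: (b12 _ _ _ (b23 _ _ _ (b12 _ _ _ (sorted _ _ _ h23 h12)))).
- exact: (b12 _ _ _ (b23 _ _ _ (b12 _ _ _ (sorted _ _ _ h23 h12)))).
Qed.

End distortion_lower_bound.

(** * The distortion as a pair of one-dimensional integrals *)

Section distortion_formula.
Context {R : realType}.
Implicit Types (p q z : R * R).

Lemma min_sqdist_set3 p1 p2 p3 z :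
  min_sqdist [set p1; p2; p3] z = (nearest p1 p2 p3 z)%:E.
Proof.
apply/eqP; rewrite eq_le; apply/andP; split.
- rewrite /nearest; have [_|_] := leP (sqdist z p1) _.
    by apply: ereal_inf_lbound; exists p1 => //; left; left.
  have [_|_] := leP (sqdist z p2) _.
    by apply: ereal_inf_lbound; exists p2 => //; left; right.
  by apply: ereal_inf_lbound; exists p3 => //; right.
- apply: le_ereal_inf_tmp => _ [q [[->|->]|->] <-]; rewrite lee_fin /nearest.
  + by rewrite ge_min lexx.
  + by rewrite !ge_min lexx orbT.
  + by rewrite !ge_min lexx !orbT.
Qed.

Lemma sqdist_ge0 z p : 0 <= sqdist z p.
Proof. by rewrite addr_ge0 ?sqr_ge0. Qed.

Lemma nearest_ge0 p1 p2 p3 z : 0 <= nearest p1 p2 p3 z.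
Proof. by rewrite /nearest !le_min !sqdist_ge0. Qed.

Lemma measurable_sqdist p : measurable_fun setT (fun z => sqdist z p).
Proof.
apply: measurable_funD; apply: measurable_funX; apply: measurable_funB => //.
Qed.

Lemma measurable_nearest p1 p2 p3 :
  measurable_fun setT (fun z => (nearest p1 p2 p3 z)%:E).
Proof.
apply/measurable_EFinP.
by apply: measurable_minr; [|apply: measurable_minr]; exact: measurable_sqdist.
Qed.

(** The densities are [1 / 4] and [1 / (2 * pi)]; taking out [1 / (4 * pi)] leaves the weights [pi]
    and [2]. *)
Lemma distortion_set3 p1 p2 p3 :
  distortion (mixed_distribution R) [set p1; p2; p3] =
  ((4 * pi)^-1 * (pi * itg (-1) 1 (fun x => nearest p1 p2 p3 (on_diameter x)) +
    2 * itg 0 pi (fun x => nearest p1 p2 p3 (on_semicircle x))))%:E.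
Proof.
rewrite /distortion.
under eq_integral do rewrite min_sqdist_set3.
set f := fun z => (nearest p1 p2 p3 z)%:E.
have f0 z : (0 <= f z)%E by rewrite lee_fin nearest_ge0.
have mf : measurable_fun setT f by exact: measurable_nearest.
transitivity (\int[measure_add (mscale ((2^-1)%:nng)%R (uniform_diameter R))
  (mscale ((2^-1)%:nng)%R (uniform_semicircle R))]_z f z)%E; first by [].
rewrite ge0_integral_measure_add // !ge0_integral_mscale //.
have m1 : measurable_fun setT (f \o @diameter_param R).
  by apply: measurableT_comp => //; exact: measurable_diameter_param.
have m2 : measurable_fun setT (f \o @semicircle_param R).
  by apply: measurableT_comp => //; exact: measurable_semicircle_param.
rewrite !ge0_integral_distribution // !integral_uniform //;
  try by move=> x; exact: f0.
have -> : (\int[lebesgue_measure]_(x in `[(-1)%R, 1%R])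
    (f \o diameter_param (R:=R)) x)%E =
    (itg (-1) 1 (fun x => nearest p1 p2 p3 (on_diameter x)))%:E.
  by rewrite -itg_EFin //; exact: continuous_nearest_diameter.
have -> : (\int[lebesgue_measure]_(x in `[0%R, pi])
    (f \o semicircle_param (R:=R)) x)%E =
    (itg 0 pi (fun x => nearest p1 p2 p3 (on_semicircle x)))%:E.
  by rewrite -itg_EFin //; exact: continuous_nearest_semicircle.
rewrite -!EFinM -EFinD /= subr0; congr EFin.
have /lt0r_neq0 := pi_gt0 R; move: (itg _ _ _) (itg _ _ _) => A B.
move: (@pi R) => P P0.
have -> : 1 - -1 = 2 :> R by ring.
by field.
Qed.

End distortion_formula.

(** * The optimal configuration *)

Section optimal_configuration.
Local Open Scope card_scope.
Context {R : realType}.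
Implicit Types (p q : R * R).
Variable t : R.
Hypothesis ht : encl t (9061333690, 9061333696)%Z.
Hypothesis st : stationarity t = 0.

(** [(opt_x, opt_y)] is the centroid of the right-hand cell and [(0, opt_top)] that of the upper
    cell. *)
Definition opt_x : R := (pi + 4 * sin t) / (2 * mass t).
Definition opt_y : R := 2 * (1 - cos t) / mass t.
Definition opt_top : R := 2 * cos t / gap t.
Definition opt_value : R :=
  (2 * (pi * (1 - nu t)) + w0 t + 2 * w1 t) / (4 * pi).
Definition opt_means : set (R * R) :=
  [set (- opt_x, opt_y); (0, opt_top); (opt_x, opt_y)].

Lemma itg_semicircle p (a b : R) : a <= b ->
  itg a b (fun x => sqdist (on_semicircle x) p) =
  (1 + p.1 ^+ 2 + p.2 ^+ 2) * (b - a) - 2 * p.1 * (sin b - sin a)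
  - 2 * p.2 * (cos a - cos b).
Proof.
move=> ab; have := itg_sqdist_semicircle p 0 ab; rewrite subr0 => <-.
by apply: eq_itg => x _; rewrite subr0.
Qed.

(** For an upper bound any assignment of points to centres will do: the diameter is cut at 0 and the
    semicircle at [t] and [pi - t], and each piece is charged to its own centre. *)
Lemma nearest_opt_le :
  pi * itg (-1) 1 (fun x => nearest (- opt_x, opt_y) (0, opt_top)
    (opt_x, opt_y) (on_diameter x))
  + 2 * itg 0 pi (fun x => nearest (- opt_x, opt_y) (0, opt_top)
    (opt_x, opt_y) (on_semicircle x)) <=
  2 * (pi * (1 - nu t)) + w0 t + 2 * w1 t.
Proof.
set near := nearest _ _ _; pose a := (- opt_x, opt_y); pose b : R * R := (0, opt_top).
pose c := (opt_x, opt_y).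
have cd : continuous (fun x => near (on_diameter x)).
  exact: continuous_nearest_diameter.
have cs : continuous (fun x => near (on_semicircle x)).
  exact: continuous_nearest_semicircle.
have na z : near z <= sqdist z a by rewrite /near /nearest ge_min lexx.
have nb z : near z <= sqdist z b by rewrite /near /nearest !ge_min lexx orbT.
have nc z : near z <= sqdist z c by rewrite /near /nearest !ge_min lexx !orbT.
have /andP[t1 t2] := t_bounds ht; have g0 := gap_gt0 ht; have m0 := mass_gt0 ht.
have t0 : 0 <= t by lra.
have tg : t <= pi - t by move: g0; rewrite /gap; move: (@pi R) => *; lra.
have gp : pi - t <= pi by rewrite gerBl.
have l1 : (-1 : R) <= 0 by lra.
rewrite (itg_add cd l1 ler01) (itg_add cs t0 (le_trans tg gp)).
rewrite (itg_add cs tg gp).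
have ka : itg (-1) 0 (fun x => near (on_diameter x)) <=
    itg (-1) 0 (fun x => sqdist (on_diameter x) a).
  by apply: itg_le => // ; exact: continuous_sqdist_diameter.
have kc : itg 0 1 (fun x => near (on_diameter x)) <=
    itg 0 1 (fun x => sqdist (on_diameter x) c).
  by apply: itg_le => // ; exact: continuous_sqdist_diameter.
have sc : itg 0 t (fun x => near (on_semicircle x)) <=
    itg 0 t (fun x => sqdist (on_semicircle x) c).
  by apply: itg_le => // ; exact: continuous_sqdist_semicircle.
have sb : itg t (pi - t) (fun x => near (on_semicircle x)) <=
    itg t (pi - t) (fun x => sqdist (on_semicircle x) b).
  by apply: itg_le => // ; exact: continuous_sqdist_semicircle.
have sa : itg (pi - t) pi (fun x => near (on_semicircle x)) <=
    itg (pi - t) pi (fun x => sqdist (on_semicircle x) a).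
  by apply: itg_le => // ; exact: continuous_sqdist_semicircle.
move: ka kc sc sb sa; rewrite !itg_sqdist_diameter ?ler01 // !itg_semicircle //.
rewrite /a /b /c; cbn [fst snd].
have sE : sin (pi - t) = sin t by rewrite sinB sinpi cospi; ring.
have cE : cos (pi - t) = - cos t by rewrite cosB sinpi cospi; ring.
rewrite sE cE sinpi cospi sin0 cos0.
move: (itg (-1) 0 _) (itg 0 1 _) (itg 0 t _) (itg t _ _) (itg _ pi _).
move=> D1 D2 S1 S2 S3 k1 k2 k3 k4 k5.
have hD := ler_wpM2l (pi_ge0 R) (lerD k1 k2).
apply: (le_trans (lerD hD (ler_wpM2l (ler0n R 2)
  (lerD k3 (lerD k4 k5))))).
rewrite le_eqVlt; apply/orP; left; apply/eqP.
(* [e1] evaluates the two lower cells together, equal by reflection, and [e2] the upper cell. *)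
have e1 : 2 * ((pi / 12 + pi / 4 + 2 * t) + mass t * (opt_x ^+ 2 + opt_y ^+ 2)
    - opt_x * (pi + 4 * sin t) - 4 * opt_y * (1 - cos t)) =
    2 * (w1 t + 2 * (1 - nu t) * t).
  congr (2 * _); rewrite /w1 /q0 /opt_x /opt_y.
  have hs : sin t ^+ 2 = 1 - cos t ^+ 2 by rewrite sin2cos2.
  have := lt0r_neq0 m0; rewrite /mass.
  move: (@pi R) (nu t) (sin t) (cos t) hs => P n s k hs m0'.
  apply/eqP; rewrite -subr_eq0; apply/eqP.
  transitivity ((- 4 * (s ^+ 2 - (1 - k ^+ 2))) / (P + 2 * t)); first by field.
  by rewrite hs subrr mulr0 mul0r.
have e2 : 2 * ((1 + opt_top ^+ 2) * gap t - 4 * opt_top * cos t) =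
    w0 t + 2 * (1 - nu t) * gap t.
  rewrite /w0 /opt_top; move: (gap t) (lt0r_neq0 g0) (nu t) (cos t) => *.
  by field.
transitivity (2 * (w1 t + 2 * (1 - nu t) * t) + (w0 t + 2 * (1 - nu t) * gap t)).
  rewrite -e1 -e2 /mass /gap.
  by move: (@pi R) (opt_x) (opt_y) (opt_top) (sin t) (cos t) => *; field.
by rewrite /gap; move: (@pi R) (nu t) => *; ring.
Qed.

Lemma opt_value_ge p1 p2 p3 :
  (opt_value%:E <= distortion (mixed_distribution R) [set p1; p2; p3])%E.
Proof.
rewrite distortion_set3 lee_fin /opt_value mulrC.
apply: ler_wpM2l; first by rewrite invr_ge0 mulr_ge0 // pi_ge0.
by rewrite mulrA; exact: nearest_ge.
Qed.

Lemma opt_value_le :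
  (distortion (mixed_distribution R) opt_means <= opt_value%:E)%E.
Proof.
rewrite /opt_means distortion_set3 lee_fin /opt_value mulrC.
apply: ler_wpM2r; first by rewrite invr_ge0 mulr_ge0 // pi_ge0.
exact: nearest_opt_le.
Qed.

Lemma card_set3 p1 p2 p3 : [set p1; p2; p3] #<= `I_3.
Proof.
pose f k := if k == 0%N then p1 else if k == 1%N then p2 else p3.
have : f @` `I_3 #<= `I_3 by exact: card_image_le.
apply: card_le_trans; apply: subset_card_le => z [[->|->]|->].
- by exists 0%N.
- by exists 1%N.
- by exists 2%N.
Qed.

Lemma card_le3 (alpha : set (R * R)) : alpha #<= `I_3 -> alpha !=set0 ->
  exists p1 p2 p3, alpha = [set p1; p2; p3].
Proof.
move=> /pcard_leP[f] [x0 ax0].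
(* The default [x0] lies in [alpha], so indices that [f] misses merely repeat a point. *)
pose g k := xget x0 [set x | alpha x /\ f x = k].
have ag k : alpha (g k) by rewrite /g; case: xgetP => [x -> []|].
have gf x : alpha x -> g (f x) = x.
  move=> ax; rewrite /g; case: xgetP => [y -> [ay fy]|/(_ x) []//].
  by apply: (@inj _ _ _ f); rewrite ?inE.
exists (g 0%N), (g 1%N), (g 2%N); apply/seteqP; split => [x ax|x].
  have /= := @funS _ _ _ _ f x ax; rewrite -{2 3 4}(gf x ax).
  by case: (f x) => [|[|[|]]]//= _; [left; left|left; right|right].
by case=> [[->|->]|->]; exact: ag.
Qed.

Lemma distortion_set0 : distortion (mixed_distribution R) set0 = +oo%E.
Proof.
rewrite /distortion.
under eq_integral do rewrite /min_sqdist image_set0 ereal_inf0.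
rewrite (integral_cst (mixed_distribution R) measurableT +oo%E).
transitivity (+oo * 1 : \bar R)%E; last by rewrite mule1.
by congr (_ * _)%E; exact: mixed_distribution_setT.
Qed.

Lemma quantization_errorE :
  quantization_error (mixed_distribution R) 3 = opt_value%:E.
Proof.
apply/eqP; rewrite eq_le; apply/andP; split.
  apply: le_trans opt_value_le; apply: ereal_inf_lbound.
  by exists opt_means => //; exact: card_set3.
apply: le_ereal_inf_tmp => _ [alpha ha <-].
have [->|/set0P/(card_le3 ha)[p1 [p2 [p3 ->]]]] := eqVneq alpha set0.
  by rewrite distortion_set0 leey.
exact: opt_value_ge.
Qed.

Lemma optimal_means_opt : optimal_means (mixed_distribution R) 3 opt_means.
Proof.
split; first exact: card_set3.
rewrite quantization_errorE; apply/eqP.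
by rewrite eq_le opt_value_le opt_value_ge.
Qed.

End optimal_configuration.

(** * Decimal values of the centres and of the error *)

Section decimals.
Context {R : realType}.

(** [a + 1] is the displayed integer; its neighbours [a] and [b] turn the tolerance of one unit into
    two polynomial inequalities. *)
Lemma decimal_close (n d a b D : R) : 0 < d -> 0 < D -> b = a + 2 ->
  0 < D * n - a * d -> 0 < b * d - D * n ->
  `|n / d - (a + 1) / D| < 1 / D.
Proof.
move=> d0 D0 -> h1 h2.
have e1 : a / D < n / d by rewrite ltr_pdivlMr // mulrAC ltr_pdivrMr //; lra.
have e2 : n / d < (a + 2) / D by rewrite ltr_pdivrMr // mulrAC ltr_pdivlMr //; lra.
have f1 : (a + 1) / D = a / D + 1 / D by field; exact: lt0r_neq0.
have f2 : (a + 2) / D = a / D + 2 * (1 / D) by field; exact: lt0r_neq0.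
move: e1 e2; rewrite f1 f2; move: (a / D) (n / d) (1 / D) => x y z e1 e2.
by rewrite ltr_norml; apply/andP; split; lra.
Qed.

Lemma decimal_check bs vs b (v w : R) n d k D :
  encl_seq bs vs -> encl v b ->
  w = peval (trig_env 0 0 v vs) n / peval (trig_env 0 0 v vs) d ->
  [&& (0 <? D)%Z, point_check bs b d,
      point_check bs b (D%:I * n - (k - 1)%:I * d)%px &
      point_check bs b ((k + 1)%:I * d - D%:I * n)%px] ->
  `|w - zr k / zr D| < 1 / zr D.
Proof.
move=> hvs hv -> /and4P[h0 h1 h2 h3].
have -> : zr k = zr (k - 1) + 1 :> R by rewrite -zr1 -zrD Z.sub_add.
apply: (decimal_close (b := zr (k + 1))).
- exact: point_checkP hvs hv h1.
- exact: zr_gt0.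
- have -> : (k + 1 = k - 1 + 2)%Z by lia.
  by rewrite zrD (zr_nat 2 : zr 2 = 2 :> R).
- exact: point_checkP hvs hv h2.
- exact: point_checkP hvs hv h3.
Qed.

Variable t : R.
Hypothesis ht : encl t (9061333690, 9061333696)%Z.

Let hpi := encl_cons (@pi_encl R) encl_nil.

Lemma opt_x_decimal : `|opt_x t - 634868%:R / 10 ^+ 6| < 1 / 10 ^+ 6.
Proof.
have := decimal_check (n := (#5 + 4%:I * #3)%px)
  (d := (2%:I * (#5 + 2%:I * #2))%px) (k := 634868%Z) (D := 1000000%Z)
  (w := opt_x t) hpi ht.
rewrite /opt_x /mass; cbn [peval trig_env nth csts]; rewrite !zrE => /(_ erefl) h.
have {h} := h ltac:(vm_cast_no_check (erefl true)).
(* Each use of [zr_nat] converts a unary numeral, hence the splitting into small numbers. *)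
have -> : (634868 = 634 * 1000 + 868)%Z by [].
have -> : (1000000 = 1000 * 1000)%Z by [].
rewrite zrD !zrM.
rewrite (zr_nat 634 : zr 634 = 634 :> R).
rewrite (zr_nat 868 : zr 868 = 868 :> R).
rewrite (zr_nat 1000 : zr 1000 = 1000 :> R).
have -> : 634 * 1000 + 868 = 634868%:R :> R by lra.
by have -> : 1000 * 1000 = 10 ^+ 6 :> R by lra.
Qed.

Lemma opt_y_decimal : `|opt_y t - 15471%:R / 10 ^+ 5| < 1 / 10 ^+ 5.
Proof.
have := decimal_check (n := (2%:I * (1%:I - #4))%px)
  (d := (#5 + 2%:I * #2)%px) (k := 15471%Z) (D := 100000%Z)
  (w := opt_y t) hpi ht.
rewrite /opt_y /mass; cbn [peval trig_env nth csts]; rewrite !zrE => /(_ erefl) h.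
have {h} := h ltac:(vm_cast_no_check (erefl true)).
have -> : (15471 = 15 * 1000 + 471)%Z by [].
have -> : (100000 = 100 * 1000)%Z by [].
rewrite zrD !zrM.
rewrite (zr_nat 15 : zr 15 = 15 :> R).
rewrite (zr_nat 471 : zr 471 = 471 :> R).
rewrite (zr_nat 100 : zr 100 = 100 :> R).
rewrite (zr_nat 1000 : zr 1000 = 1000 :> R).
have -> : 15 * 1000 + 471 = 15471%:R :> R by lra.
by have -> : 100 * 1000 = 10 ^+ 5 :> R by lra.
Qed.

Lemma opt_top_decimal : `|opt_top t - 92798%:R / 10 ^+ 5| < 1 / 10 ^+ 5.
Proof.
have := decimal_check (n := (2%:I * #4)%px)
  (d := (#5 - 2%:I * #2)%px) (k := 92798%Z) (D := 100000%Z)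
  (w := opt_top t) hpi ht.
rewrite /opt_top /gap; cbn [peval trig_env nth csts]; rewrite !zrE => /(_ erefl) h.
have {h} := h ltac:(vm_cast_no_check (erefl true)).
have -> : (92798 = 92 * 1000 + 798)%Z by [].
have -> : (100000 = 100 * 1000)%Z by [].
rewrite zrD !zrM.
rewrite (zr_nat 92 : zr 92 = 92 :> R).
rewrite (zr_nat 798 : zr 798 = 798 :> R).
rewrite (zr_nat 100 : zr 100 = 100 :> R).
rewrite (zr_nat 1000 : zr 1000 = 1000 :> R).
have -> : 92 * 1000 + 798 = 92798%:R :> R by lra.
by have -> : 100 * 1000 = 10 ^+ 5 :> R by lra.
Qed.

Lemma opt_value_decimal : `|opt_value t - 147821%:R / 10 ^+ 6| < 1 / 10 ^+ 6.
Proof.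
have := decimal_check (n := (2%:I * (#5 * (1%:I - #7)) + #8 + 2%:I * #9)%px)
  (d := (4%:I * #5)%px) (k := 147821%Z) (D := 1000000%Z)
  (w := opt_value t) (csts_encl ht) ht.
rewrite /opt_value; cbn [peval trig_env nth csts]; rewrite !zrE => /(_ erefl) h.
have {h} := h ltac:(vm_cast_no_check (erefl true)).
have -> : (147821 = 147 * 1000 + 821)%Z by [].
have -> : (1000000 = 1000 * 1000)%Z by [].
rewrite zrD !zrM.
rewrite (zr_nat 147 : zr 147 = 147 :> R).
rewrite (zr_nat 821 : zr 821 = 821 :> R).
rewrite (zr_nat 1000 : zr 1000 = 1000 :> R).
have -> : 147 * 1000 + 821 = 147821%:R :> R by lra.
by have -> : 1000 * 1000 = 10 ^+ 6 :> R by lra.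
Qed.

End decimals.

Theorem proposition4p5 (R : realType) :
  (exists a b c : R * R,
    optimal_means (mixed_distribution R) 3 [set a; b; c] /\
    (`|a.1 - (- (634868%:R / 10 ^+ 6))| < 1 / 10 ^+ 6 /\
     `|a.2 - 15471%:R / 10 ^+ 5| < 1 / 10 ^+ 5) /\
    (b.1 = 0 /\
     `|b.2 - 92798%:R / 10 ^+ 5| < 1 / 10 ^+ 5) /\
    (`|c.1 - 634868%:R / 10 ^+ 6| < 1 / 10 ^+ 6 /\
     `|c.2 - 15471%:R / 10 ^+ 5| < 1 / 10 ^+ 5)) /\
  (`|quantization_error (mixed_distribution R) 3
       - (147821%:R / 10 ^+ 6)%:E| < (1 / 10 ^+ 6)%:E)%E.
Proof.
have [t [st ht]] := @tau_exists R.
have hx := opt_x_decimal ht; have hy := opt_y_decimal ht.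
split.
  exists (- opt_x t, opt_y t), (0, opt_top t), (opt_x t, opt_y t).
  split; first exact: optimal_means_opt ht st.
  split; first split.
  - rewrite -opprD normrN; exact: hx.
  - exact: hy.
  split; first split.
  - exact: erefl.
  - exact: opt_top_decimal ht.
  split; [exact: hx | exact: hy].
rewrite (quantization_errorE ht st) -EFinB abse_EFin lte_fin.
exact: opt_value_decimal ht.
Qed.
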